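(* Let $F$ be a field and let $A$ be a finite-dimensional local $F$-algebra such that $F$ is a splitting field for $A$. Suppose that $A$ admits two irreducible tensor factorizations $$A \cong P_1 \otimes \dotsb \otimes P_n \cong Q_1 \otimes \dotsb \otimes Q_m,$$ where $P_1, \dotsc, P_n$ and $Q_1, \dotsc, Q_m$ are irreducible $F$-algebras. Then $n = m$ and, after reordering indices, $P_i \cong Q_i$ (as $F$-algebras) for every $i$.
   Context: All algebras are associative, finite-dimensional over the field $F$, with identity $1 \neq 0$ (not necessarily commutative). All tensor products $\otimes$ are over $F$; the empty tensor product is understood to be $F$ (so $n$ or $m$ may be $0$). For an algebra $A$ with Jacobson radical $J_A$: $A$ is local if $A/J_A$ is a division algebra; $F$ is a splitting field for $A$ (equivalently, $A$ splits over $F$) if $A/J_A$ is isomorphic to a direct product of matrix algebras over $F$. An algebra is trivial if it is isomorphic to $F$. An algebra $B$ is a tensor factor of $A$ if $A \cong B \otimes C$ for some algebra $C$. A non-trivial algebra $P$ is irreducible if every tensor factor of $P$ is isomorphic to $F$ or to $P$. A tensor factorization $A \cong P_1 \otimes \dotsb \otimes P_n$ is irreducible if all of $P_1, \dotsc, P_n$ are irreducible. *)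

(* Defs.v *)
From HB Require Import structures.
From mathcomp Require Import all_boot all_order all_algebra all_field.
From mathcomp Require Import boolp.

Set Implicit Arguments.
Unset Strict Implicit.
Unset Printing Implicit Defensive.

Import GRing.Theory.
Local Open Scope ring_scope.

Section AlgebraIsomorphism.
Variable F : fieldType.

Definition alg_iso (A B : algType F) : Prop :=
  exists f : {lrmorphism A -> B}, bijective f.

Definition division_algebra (D : falgType F) : Prop :=
  forall x : D, x != 0 -> x \is a GRing.unit.

End AlgebraIsomorphism.

(* The elements of A (x) B are the matrices of coordinates with respect to    *)
(* the products of the elements of the bases vbasis {:A} and vbasis {:B};     *)
(* tens a b is the pure tensor of a and b.  The multiplication is the         *)
(* bilinear map with (a (x) b) (a' (x) b') = aa' (x) bb' (lemma tensM).       *)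
Section Tensor.
Variables (F : fieldType) (A B : falgType F).

Definition tensor : Type := 'M[F]_(\dim {:A}, \dim {:B}).

HB.instance Definition _ :=
  Vector.copy tensor 'M[F]_(\dim {:A}, \dim {:B}).

Definition tens (a : A) (b : B) : tensor :=
  \matrix_(i, j) (coord (vbasis {:A}) i a * coord (vbasis {:B}) j b).

Local Notation eA i := (vbasis {:A})`_i.
Local Notation eB j := (vbasis {:B})`_j.

Definition tensor_mul (x y : tensor) : tensor :=
  \sum_(i < \dim {:A}) \sum_(j < \dim {:B})
    \sum_(k < \dim {:A}) \sum_(l < \dim {:B})
      (x i j * y k l) *: tens (eA i * eA k) (eB j * eB l).

Lemma tensDl a a' b : tens (a + a') b = tens a b + tens a' b.
Proof. by apply/matrixP => i j; rewrite !mxE linearD mulrDl. Qed.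

Lemma tensDr a b b' : tens a (b + b') = tens a b + tens a b'.
Proof. by apply/matrixP => i j; rewrite !mxE linearD mulrDr. Qed.

Lemma tensZl c a b : tens (c *: a) b = c *: tens a b.
Proof. by apply/matrixP => i j; rewrite !mxE linearZ /= mulrA. Qed.

Lemma tensZr c a b : tens a (c *: b) = c *: tens a b.
Proof. by apply/matrixP => i j; rewrite !mxE linearZ /= mulrCA. Qed.

Lemma tens0l b : tens 0 b = 0.
Proof. by apply/matrixP => i j; rewrite !mxE linear0 mul0r. Qed.

Lemma tens0r a : tens a 0 = 0.
Proof. by apply/matrixP => i j; rewrite !mxE linear0 mulr0. Qed.

Lemma tens_suml I (r : seq I) (f : I -> A) b :
  tens (\sum_(i <- r) f i) b = \sum_(i <- r) tens (f i) b.
Proof.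
exact: (big_morph (fun a => tens a b) (fun a a' => tensDl a a' b) (tens0l b)).
Qed.

Lemma tens_sumr I (r : seq I) a (f : I -> B) :
  tens a (\sum_(i <- r) f i) = \sum_(i <- r) tens a (f i).
Proof. by rewrite (big_morph (tens a) (tensDr a) (tens0r a)). Qed.

Lemma tens_basisE i j (k : 'I_(\dim {:A})) (l : 'I_(\dim {:B})) :
  tens (eA k) (eB l) i j = (i == k)%:R * (j == l)%:R.
Proof.
by rewrite mxE !coord_free ?(basis_free (vbasisP _)) // (eq_sym k) (eq_sym l).
Qed.

Lemma tensor_decomp (x : tensor) :
  x = \sum_(i < \dim {:A}) \sum_(j < \dim {:B}) x i j *: tens (eA i) (eB j).
Proof.
apply/matrixP => i j; rewrite summxE (bigD1 i) //= summxE (bigD1 j) //=.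
rewrite !mxE !coord_free ?(basis_free (vbasisP _)) // !eqxx !mulr1.
rewrite big1 => [|l nl]; last first.
  rewrite mxE tens_basisE (eq_sym j) (negPf nl) mulr0 mulr0 //.
rewrite addr0 big1 ?addr0 // => k nk; rewrite summxE big1 // => l _.
by rewrite mxE tens_basisE (eq_sym i) (negPf nk) mul0r mulr0.
Qed.

Lemma tensor_ind (P : tensor -> Prop) :
    P 0 -> (forall x y, P x -> P y -> P (x + y)) ->
    (forall a b, P (tens a b)) -> forall x, P x.
Proof.
move=> P0 PD Pt x; rewrite [x]tensor_decomp.
apply: (big_ind P) => // i _; apply: (big_ind P) => // j _.
by rewrite -tensZl.
Qed.

Lemma tensor_mulDl : left_distributive tensor_mul +%R.
Proof.
move=> x y z; rewrite /tensor_mul -big_split; apply: eq_bigr => i _ /=.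
rewrite -big_split; apply: eq_bigr => j _ /=.
rewrite -big_split; apply: eq_bigr => k _ /=.
rewrite -big_split; apply: eq_bigr => l _ /=.
by rewrite mxE mulrDl scalerDl.
Qed.

Lemma tensor_mulDr : right_distributive tensor_mul +%R.
Proof.
move=> x y z; rewrite /tensor_mul -big_split; apply: eq_bigr => i _ /=.
rewrite -big_split; apply: eq_bigr => j _ /=.
rewrite -big_split; apply: eq_bigr => k _ /=.
rewrite -big_split; apply: eq_bigr => l _ /=.
by rewrite mxE mulrDr scalerDl.
Qed.

Lemma tensor_mul0l y : tensor_mul 0 y = 0.
Proof. by apply: (addrI (tensor_mul 0 y)); rewrite -tensor_mulDl !addr0. Qed.

Lemma tensor_mul0r x : tensor_mul x 0 = 0.
Proof. by apply: (addrI (tensor_mul x 0)); rewrite -tensor_mulDr !addr0. Qed.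

Lemma tensor_mul_tens a b a' b' :
  tensor_mul (tens a b) (tens a' b') = tens (a * a') (b * b').
Proof.
rewrite {2}(coord_vbasis (memvf a)) {2}(coord_vbasis (memvf a')).
rewrite {2}(coord_vbasis (memvf b)) {2}(coord_vbasis (memvf b')).
rewrite /tensor_mul mulr_suml tens_suml; apply: eq_bigr => i _.
rewrite [in RHS]mulr_suml tens_sumr; apply: eq_bigr => j _.
rewrite mulr_sumr tens_suml; apply: eq_bigr => k _.
rewrite mulr_sumr tens_sumr; apply: eq_bigr => l _.
rewrite !mxE -!scalerAl -!scalerAr !tensZl !tensZr !scalerA.
congr (_ *: _); rewrite -!mulrA; congr (_ * _).
by rewrite [RHS]mulrCA.
Qed.

Lemma tensor_mulA : associative tensor_mul.
Proof.
move=> x y z; elim/tensor_ind: x => [|x x' IH IH'|a b].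
- by rewrite !tensor_mul0l.
- by rewrite !tensor_mulDl IH IH'.
elim/tensor_ind: y => [|y y' IH IH'|a' b'].
- by rewrite tensor_mul0r !tensor_mul0l tensor_mul0r.
- by rewrite tensor_mulDr !tensor_mulDl tensor_mulDr IH IH'.
elim/tensor_ind: z => [|z z' IH IH'|a'' b''].
- by rewrite !tensor_mul0r.
- by rewrite !tensor_mulDr IH IH'.
by rewrite !tensor_mul_tens !mulrA.
Qed.

Lemma tensor_mul1l : left_id (tens 1 1) tensor_mul.
Proof.
elim/tensor_ind => [|x y IH IH'|a b]; first exact: tensor_mul0r.
  by rewrite tensor_mulDr IH IH'.
by rewrite tensor_mul_tens !mul1r.
Qed.

Lemma tensor_mul1r : right_id (tens 1 1) tensor_mul.
Proof.
elim/tensor_ind => [|x y IH IH'|a b]; first exact: tensor_mul0l.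
  by rewrite tensor_mulDl IH IH'.
by rewrite tensor_mul_tens !mulr1.
Qed.

Lemma coord_vbasis_neq0 (V : vectType F) (v : V) :
  v != 0 -> exists i, coord (vbasis {:V}) i v != 0.
Proof.
move=> nz; apply/existsP; apply: contraR nz; rewrite negb_exists => /forallP h.
rewrite (coord_vbasis (memvf v)) big1 // => i _.
by move: (h i); rewrite negbK => /eqP ->; rewrite scale0r.
Qed.

Lemma tens_neq0 a b : a != 0 -> b != 0 -> tens a b != 0.
Proof.
move=> /coord_vbasis_neq0[i ni] /coord_vbasis_neq0[j nj].
apply/eqP => /matrixP /(_ i j); rewrite !mxE => /eqP.
by rewrite mulf_eq0 (negPf ni) (negPf nj).
Qed.

HB.instance Definition _ := GRing.Zmodule_isNzRing.Build tensor
  tensor_mulA tensor_mul1l tensor_mul1r tensor_mulDl tensor_mulDr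
  (tens_neq0 (oner_neq0 A) (oner_neq0 B)).

Lemma tensor_scaleAl c (x y : tensor) : c *: (x * y) = (c *: x) * y.
Proof.
elim/tensor_ind: x => [|x x' IH IH'|a b].
- by rewrite scaler0 !mul0r scaler0.
- by rewrite scalerDr !mulrDl scalerDr IH IH'.
elim/tensor_ind: y => [|y y' IH IH'|a' b'].
- by rewrite !mulr0 scaler0.
- by rewrite !mulrDr scalerDr IH IH'.
rewrite -tensZl; rewrite -[LHS]/(c *: tensor_mul _ _) -[RHS]/(tensor_mul _ _).
by rewrite !tensor_mul_tens -tensZl scalerAl.
Qed.
HB.instance Definition _ :=
  GRing.Lmodule_isLalgebra.Build F tensor tensor_scaleAl.

Lemma tensor_scaleAr c (x y : tensor) : c *: (x * y) = x * (c *: y).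
Proof.
elim/tensor_ind: x => [|x x' IH IH'|a b].
- by rewrite !mul0r scaler0.
- by rewrite !mulrDl scalerDr IH IH'.
elim/tensor_ind: y => [|y y' IH IH'|a' b'].
- by rewrite scaler0 !mulr0 scaler0.
- by rewrite scalerDr !mulrDr scalerDr IH IH'.
rewrite -tensZl; rewrite -[LHS]/(c *: tensor_mul _ _) -[RHS]/(tensor_mul _ _).
by rewrite !tensor_mul_tens -tensZl scalerAr.
Qed.
HB.instance Definition _ :=
  GRing.Lalgebra_isAlgebra.Build F tensor tensor_scaleAr.

HB.instance Definition _ := Algebra_isFalgebra.Build F tensor.

Lemma tensM a b a' b' : tens a b * tens a' b' = tens (a * a') (b * b').
Proof. exact: tensor_mul_tens. Qed.

Lemma tens1 : tens 1 1 = 1.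
Proof. by []. Qed.

End Tensor.

Section Ideals.
Variables (F : fieldType) (A : falgType F).

(* A contains F, so every left ideal of the ring A is an F-subspace.          *)
Definition left_ideal (L : {vspace A}) : Prop := ({:A} * L <= L)%VS.

Definition maximal_left_ideal (M : {vspace A}) : Prop :=
  [/\ left_ideal M, M <> {:A}%VS &
      forall L : {vspace A},
        left_ideal L -> (M <= L)%VS -> L = M \/ L = {:A}%VS].

Lemma left_idealP L :
  left_ideal L <-> forall a x : A, x \in L -> a * x \in L.
Proof.
split=> [/prodvP h a x Lx | h]; first by apply: h; rewrite ?memvf.
by apply/prodvP => a x _; apply: h.
Qed.

Lemma vspace_of_pred (P : A -> Prop) :
    P 0 -> (forall c x y, P x -> P y -> P (c *: x + y)) ->
  exists U : {vspace A}, forall x, x \in U <-> P x.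
Proof.
move=> P0 PL.
pose Q n := `[< exists2 U : {vspace A},
                 \dim U = n & forall x, x \in U -> P x >].
have Q0 : exists n, Q n.
  by exists 0; apply/asboolP; exists 0%VS; rewrite ?dimv0 // => x /[!memv0]/eqP->.
have Qle n : Q n -> (n <= \dim {:A})%N.
  by move=> /asboolP[U <- _]; apply/dimvS/subvf.
have [n /asboolP[U dU UP] maxn] := ex_maxnP Q0 Qle.
exists U => x; split=> [/UP //|Px].
have : Q (\dim (U + <[x]>)%VS).
  apply/asboolP; exists (U + <[x]>)%VS => // _ /memv_addP[u Uu [_ /vlineP[c ->] ->]].
  by rewrite addrC; apply: PL => //; apply: UP.
move=> /maxn; rewrite -dU => le.
have/eqP -> : (U == U + <[x]>)%VS by rewrite eqEdim addvSl.
exact: (subvP (addvSr _ _)) (memv_line x).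
Qed.

Lemma jacobson_exists :
  exists J : {vspace A}, forall x,
    x \in J <-> forall M, maximal_left_ideal M -> x \in M.
Proof.
apply: vspace_of_pred => [M _|c x y hx hy M mM]; first exact: mem0v.
by rewrite memvD ?memvZ ?hx ?hy.
Qed.

(* The intersection of all maximal left ideals. *)
Definition jacobson : {vspace A} := projT1 (cid jacobson_exists).

Lemma jacobsonP x :
  x \in jacobson <-> forall M, maximal_left_ideal M -> x \in M.
Proof. exact: (projT2 (cid jacobson_exists)). Qed.

Lemma maximal_left_ideal_exists : exists M, maximal_left_ideal M.
Proof.
pose Q n := `[< exists U : {vspace A},
                 [/\ \dim U = n, left_ideal U & U <> {:A}%VS] >].
have Q0 : exists n, Q n.
  exists 0; apply/asboolP; exists 0%VS; split; first exact: dimv0.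
    by rewrite /left_ideal prodv0.
  by move/vspaceP/(_ 1); rewrite memvf memv0 oner_eq0.
have Qle n : Q n -> (n <= \dim {:A})%N.
  by move=> /asboolP[U [<- _ _]]; apply/dimvS/subvf.
have [n /asboolP[U [dU lU pU]] maxn] := ex_maxnP Q0 Qle.
exists U; split=> // L lL UL; have [->|/eqP pL] := eqVneq L {:A}%VS; first by right.
left; apply/esym/eqP; rewrite eqEdim UL dU; apply: maxn.
by apply/asboolP; exists L.
Qed.

Definition proper_ideal (I : {vspace A}) : Prop :=
  [/\ ({:A} * I <= I)%VS, (I * {:A} <= I)%VS & 1 \notin I].

Lemma jacobson_ideal : proper_ideal jacobson.
Proof.
split.
- apply/left_idealP => a x /jacobsonP hx; apply/jacobsonP => M mM.
  by have [/left_idealP lM _ _] := mM; apply/lM/hx.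
- apply/prodvP => x a /jacobsonP hx _; apply/jacobsonP => M mM.
  have [/left_idealP lM pM maxM] := mM.
  have [//|xaM] := boolP (x * a \in M).
  have [N NP] : exists N : {vspace A}, forall y, y \in N <-> y * a \in M.
    apply: vspace_of_pred => [|c y z My Mz]; first by rewrite mul0r mem0v.
    by rewrite mulrDl -scalerAl memvD ?memvZ.
  suff /hx/NP : maximal_left_ideal N by rewrite (negPf xaM).
  have lN : left_ideal N.
    by apply/left_idealP => b y /NP My; apply/NP; rewrite -mulrA lM.
  have aM : a \notin M by apply: contra xaM => /lM.
  split=> // [/vspaceP/(_ 1)|L /left_idealP lL NL].
    by rewrite memvf => /NP; rewrite mul1r (negPf aM).
  have [LN|/subvPn[y Ly Ny]] := boolP (L <= N)%VS.
    by left; apply/eqP; rewrite eqEsubv LN.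
  right; apply/eqP; rewrite eqEsubv subvf /=; apply/subvP => z _.
  have [K KP] : exists K : {vspace A}, forall w,
      w \in K <-> exists2 m, m \in M & exists2 l, l \in L & w = m + l * a.
    apply: vspace_of_pred => [|c u v [m mM1 [l lL1 ->]] [m' mM' [l' lL' ->]]].
      by exists 0; rewrite ?mem0v //; exists 0; rewrite ?mem0v // mul0r addr0.
    exists (c *: m + m'); first by rewrite memvD ?memvZ.
    exists (c *: l + l'); first by rewrite memvD ?memvZ.
    by rewrite mulrDl scalerDr -scalerAl addrACA.
  have lK : left_ideal K.
    apply/left_idealP => b w /KP[m mM1 [l lL1 ->]]; apply/KP.
    exists (b * m); first exact: lM.
    by exists (b * l); [exact: lL | rewrite mulrDr mulrA].
  have MK : (M <= K)%VS.
    apply/subvP => m mM1; apply/KP; exists m => //.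
    by exists 0; rewrite ?mem0v // mul0r addr0.
  have yK : y * a \in K.
    by apply/KP; exists 0; rewrite ?mem0v //; exists y; rewrite ?add0r.
  have [KM|KA] := maxM K lK MK.
    by move: yK Ny; rewrite KM => h /negP[]; apply/NP.
  have /KP[m mM1 [l lL1 zE]] : z * a \in K by rewrite KA memvf.
  rewrite -(subrK l z) memvD //; apply: (subvP NL); apply/NP.
  by rewrite mulrBl zE addrK.
have [M mM] := maximal_left_ideal_exists.
apply/negP => /jacobsonP /(_ M mM) M1; have [/left_idealP lM pM _] := mM.
apply: pM; apply/eqP; rewrite eqEsubv subvf /=; apply/subvP => z _.
by rewrite -[z]mulr1 lM.
Qed.

End Ideals.

(* The quotient algebra A / I: the underlying vector space is the complement  *)
(* I^C, and quotient_pi is the canonical projection, a surjective algebra     *)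
(* morphism with kernel I (lemmas quotient_pi_surj and quotient_pi_eq0).      *)
Section Quotient.
Variables (F : fieldType) (A : falgType F) (I : {vspace A}).
Variable idI : proper_ideal I.

Definition quotient_alg of proper_ideal I : Type := subvs_of I^C%VS.
Local Notation Q := (quotient_alg idI).

HB.instance Definition _ := Vector.copy Q (subvs_of I^C%VS).

Definition quotient_pi (x : A) : Q := vsproj I^C%VS (daddv_pi I^C%VS I x).
Local Notation pi := quotient_pi.

Definition quotient_mul (u v : Q) : Q := pi (vsval u * vsval v).

Lemma quotient_pi_linear : linear pi.
Proof. by move=> c x y; rewrite /pi !linearP. Qed.
HB.instance Definition _ :=
  GRing.isLinear.Build F A Q *:%R quotient_pi quotient_pi_linear.

Lemma cap_complC : (I^C :&: I = 0)%VS.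
Proof. by rewrite capvC capv_compl. Qed.

Lemma quotient_piK : cancel (vsval : Q -> A) pi.
Proof.
move=> u; apply: val_inj; rewrite /= vsprojK ?memv_pi //.
by rewrite daddv_pi_id ?cap_complC ?subvsP.
Qed.

Lemma quotient_pi_surj (u : Q) : exists x, pi x = u.
Proof. by exists (vsval u); rewrite quotient_piK. Qed.

Lemma vsval_quotient_pi x : x - vsval (pi x) \in I.
Proof.
have xQ : x \in (I^C + I)%VS by rewrite addvC addv_complf memvf.
rewrite /quotient_pi vsprojK ?memv_pi //.
rewrite -[X in X - _](daddv_pi_add cap_complC xQ).
by rewrite addrAC subrr add0r memv_pi.
Qed.

Lemma quotient_pi_eq0 x : (pi x == 0) = (x \in I).
Proof.
apply/eqP/idP => [p0|Ix].
  have v0 : vsval (0 : Q) = 0 by exact: (linear0 (@vsval F A I^C%VS)).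
  by have := vsval_quotient_pi x; rewrite p0 v0 subr0.
apply: val_inj; apply/eqP; rewrite -[_ == _]memv0 -cap_complC memv_cap.
rewrite subvsP /=.
by rewrite -[X in X \in _](subKr x) memvB ?vsval_quotient_pi.
Qed.

Lemma quotient_pi_mul x y : quotient_mul (pi x) (pi y) = pi (x * y).
Proof.
have [lI rI _] := idI; apply/eqP; rewrite -subr_eq0 -linearB quotient_pi_eq0.
set x' := vsval (pi x); set y' := vsval (pi y).
have -> : x' * y' - x * y = - ((x - x') * y' + x * (y - y')).
  by rewrite mulrBl mulrBr [in RHS]addrC addrA subrK opprB.
rewrite memvN memvD //.
  by apply: (subvP rI); rewrite memv_mul ?memvf ?vsval_quotient_pi.
by apply: (subvP lI); rewrite memv_mul ?memvf ?vsval_quotient_pi.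
Qed.

Let pi_ind (P : Q -> Prop) : (forall x, P (pi x)) -> forall u, P u.
Proof. by move=> h u; rewrite -(quotient_piK u). Qed.

Lemma quotient_mulA : associative quotient_mul.
Proof.
elim/pi_ind => x; elim/pi_ind => y; elim/pi_ind => z.
by rewrite !quotient_pi_mul mulrA.
Qed.

Lemma quotient_mul1l : left_id (pi 1) quotient_mul.
Proof. by elim/pi_ind => x; rewrite quotient_pi_mul mul1r. Qed.

Lemma quotient_mul1r : right_id (pi 1) quotient_mul.
Proof. by elim/pi_ind => x; rewrite quotient_pi_mul mulr1. Qed.

Lemma quotient_mulDl : left_distributive quotient_mul +%R.
Proof. by move=> u v w; rewrite /quotient_mul linearD mulrDl linearD. Qed.

Lemma quotient_mulDr : right_distributive quotient_mul +%R.
Proof. by move=> u v w; rewrite /quotient_mul linearD mulrDr linearD. Qed.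

Lemma quotient_pi1_neq0 : pi 1 != 0.
Proof. by rewrite quotient_pi_eq0; case: idI. Qed.

HB.instance Definition _ := GRing.Zmodule_isNzRing.Build Q
  quotient_mulA quotient_mul1l quotient_mul1r quotient_mulDl quotient_mulDr
  quotient_pi1_neq0.

Lemma quotient_scaleAl c (u v : Q) : c *: (u * v) = (c *: u) * v.
Proof.
by rewrite -[RHS]/(pi _) linearZ /= -scalerAl linearZ.
Qed.
HB.instance Definition _ :=
  GRing.Lmodule_isLalgebra.Build F Q quotient_scaleAl.

Lemma quotient_scaleAr c (u v : Q) : c *: (u * v) = u * (c *: v).
Proof.
by rewrite -[RHS]/(pi _) linearZ /= -scalerAr linearZ.
Qed.
HB.instance Definition _ :=
  GRing.Lalgebra_isAlgebra.Build F Q quotient_scaleAr.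

HB.instance Definition _ := Algebra_isFalgebra.Build F Q.

Lemma quotient_pi_monoid_morphism : monoid_morphism quotient_pi.
Proof. by split=> // x y; rewrite -quotient_pi_mul. Qed.
HB.instance Definition _ :=
  GRing.isMonoidMorphism.Build A Q quotient_pi quotient_pi_monoid_morphism.

End Quotient.

Section Factorization.
Variable F : fieldType.

Definition mod_jacobson (A : falgType F) : falgType F :=
  quotient_alg (jacobson_ideal A).

Definition local_algebra (A : falgType F) : Prop :=
  division_algebra (mod_jacobson A).

(* The direct product of the matrix algebras of sizes n.+1 and m.+1 for m     *)
(* in s; as A / J_A is nonzero, the empty product is not needed.              *)
Fixpoint matrix_product (n : nat) (s : seq nat) : algType F :=
  if s is m :: s' then ('M[F]_n.+1 * matrix_product m s')%type
  else 'M[F]_n.+1.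

Definition splitting_field (A : falgType F) : Prop :=
  exists n s, alg_iso (mod_jacobson A) (matrix_product n s).

Definition trivial_algebra (A : falgType F) : Prop := alg_iso A F^o.

Definition tensor_factor (B A : falgType F) : Prop :=
  exists C : falgType F, alg_iso A (tensor B C).

Definition irreducible_algebra (P : falgType F) : Prop :=
  ~ trivial_algebra P /\
  forall B : falgType F, tensor_factor B P -> alg_iso B F^o \/ alg_iso B P.

(* P 0 (x) (P 1 (x) ... (P (n - 1) (x) F)); the algebra F when n = 0. *)
Fixpoint tensor_family (n : nat) : ('I_n -> falgType F) -> falgType F :=
  if n is n'.+1 then
    fun P => tensor (P ord0) (tensor_family (fun i : 'I_n' => P (lift ord0 i)))
  else fun=> F^o.

End Factorization.

(* Main.v *)
(* Modulo its radical J, a local algebra split by F is F, so it carries an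
   augmentation onto F with nilpotent kernel J, and so does each of its tensor
   factors.  Let A = P (x) P' = Q (x) R with P irreducible, and let u and v be
   the endomorphisms of P obtained by projecting to Q, respectively to R, and
   back.  On J/J^2 one has u + v = 1.

   Fitting's lemma holds for u: let K = ker u^n for n large, and let D be the
   right ideal generated by u^n(J).  As P is a tensor factor of A, u^n(P) and
   its centraliser together generate P, so D is two-sided.  The map
   P -> Q (x) R -> P/K (x) P/D is surjective on J/J^2, hence surjective;
   Nakayama's lemma over u^n(P) gives dim P <= dim P/K * dim P/D, so
   the map is an isomorphism.  As P is irreducible, u is bijective or u^n is
   the augmentation; in the latter case v is surjective on J/J^2, hence
   bijective.

   Splitting off the Q_j one at a time thus yields a j such that P -> Q_j -> P
   is bijective.  Fitting's lemma for Q_j then makes P -> Q_j bijective, and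
   the complementary factors are isomorphic because the projection between
   them is surjective on J/J^2. *)
From HB Require Import structures.
From mathcomp Require Import all_boot all_order all_algebra all_field.
From mathcomp Require Import boolp.
Require Import Defs.

Set Implicit Arguments.
Unset Strict Implicit.
Unset Printing Implicit Defensive.

Import GRing.Theory.
Local Open Scope ring_scope.

(** * Homomorphisms and tensor products *)

Section AlgebraHomomorphisms.
Variable F : fieldType.
Implicit Types A B C : falgType F.

Definition mk_ahom A B (f : A -> B) (lf : linear f)
  (mf : monoid_morphism f) : 'AHom(A, B) :=
  let f1 := GRing.isLinear.Build F A B *:%R f lf in
  let f2 := GRing.isMonoidMorphism.Build A B f mf in
  linfun_ahom (HB.pack_for {lrmorphism A -> B} f f1 f2).

Lemma mk_ahomE A B f lf mf x : @mk_ahom A B f lf mf x = f x.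
Proof. by rewrite lfunE. Qed.

Lemma alg_isoP A B : alg_iso A B <-> exists f : 'AHom(A, B), bijective f.
Proof.
split=> [[f [g fK gK]]|[f bf]].
  by exists (linfun_ahom f), g => x; rewrite lfunE /= ?fK ?gK.
by exists (f : {lrmorphism A -> B}).
Qed.

Lemma bij_ahom_inv A B (f : 'AHom(A, B)) :
  bijective f -> exists g : 'AHom(B, A), cancel f g /\ cancel g f.
Proof.
case=> g fK gK.
have lg : linear g.
  by move=> c x y; apply: (can_inj fK); rewrite linearP /= !gK.
have mg : monoid_morphism g.
  by split=> [|x y]; apply: (can_inj fK); rewrite ?rmorph1 ?rmorphM /= ?gK.
by exists (mk_ahom lg mg); split=> x; rewrite mk_ahomE.
Qed.

Lemma alg_iso_sym A B : alg_iso A B -> alg_iso B A.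
Proof.
move=> /alg_isoP[f /bij_ahom_inv[g [fK gK]]].
by apply/alg_isoP; exists g; exists f.
Qed.

Lemma alg_iso_trans A B C : alg_iso A B -> alg_iso B C -> alg_iso A C.
Proof.
move=> /alg_isoP[f bf] /alg_isoP[g bg]; apply/alg_isoP.
exists (comp_ahom g f); apply: (eq_bij (bij_comp bg bf)) => x /=.
by rewrite comp_lfunE.
Qed.

Lemma surj_limg A B (f : 'Hom(A, B)) :
  (forall y, exists x, f x = y) -> limg f = fullv.
Proof.
move=> sf; apply/vspaceP => y; rewrite memvf; have [x <-] := sf y.
exact/memv_img/memvf.
Qed.

Lemma inj_bij_lfun A B (f : 'Hom(A, B)) :
  injective f -> (\dim {:B} <= \dim {:A})%N -> bijective f.
Proof.
move=> injf le; have k0 : lker f == 0%VS by apply/lker0P.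
exists (f^-1%VF); first exact: lker0_lfunK.
move=> y; apply: limg_lfunVK.
suff/eqP -> : limg f == fullv by apply: memvf.
by rewrite eqEdim subvf limg_dim_eq // (eqP k0) capv0.
Qed.

Lemma inj_dim A B (f : 'Hom(A, B)) :
  injective f -> (\dim {:A} <= \dim {:B})%N.
Proof.
move=> /lker0P/eqP k0.
by rewrite -(limg_dim_eq (f := f) (U := fullv)) ?dimvS ?subvf // k0 capv0.
Qed.

Lemma surj_bij_lfun A B (f : 'Hom(A, B)) :
  (forall y, exists x, f x = y) -> (\dim {:A} <= \dim {:B})%N -> bijective f.
Proof.
move=> sf le; apply: inj_bij_lfun.
  apply/lker0P; have := limg_ker_dim f fullv; rewrite (surj_limg sf) capfv => E.
  by rewrite -dimv_eq0 -leqn0 -(leq_add2r (\dim {:B})) E.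
by rewrite -(surj_limg sf) -[X in (_ <= X)%N](limg_ker_dim f) leq_addl.
Qed.

Lemma dim_alg_iso A B : alg_iso A B -> \dim {:A} = \dim {:B}.
Proof.
move=> AB; apply/eqP; rewrite eqn_leq; apply/andP; split.
  by have /alg_isoP[f /bij_inj/inj_dim] := AB.
by have /alg_isoP[f /bij_inj/inj_dim] := alg_iso_sym AB.
Qed.

Lemma dim_regular : \dim {: F^o} = 1%N.
Proof. by rewrite dimvf. Qed.

Lemma dim_gt0 A : (0 < \dim {:A})%N.
Proof. by rewrite dimvf; apply: FalgType_proper. Qed.

End AlgebraHomomorphisms.

(** * Homomorphisms into, out of and between tensor products *)

Section TensorHomomorphisms.
Variable F : fieldType.
Implicit Types A B C D : falgType F.

Lemma dim_tensor A B : \dim {: tensor A B} = (\dim {:A} * \dim {:B})%N.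
Proof. by rewrite dimvf. Qed.

(** The map given by the universal property of the tensor product, in coordinates. It is linear for
    all [f] and [g]; it is multiplicative because of the commutation hypothesis [fg] of the next
    section. *)
Definition lift_fun A B C (f : 'AHom(A, C)) (g : 'AHom(B, C))
  (x : tensor A B) : C :=
  \sum_i \sum_j x i j *: (f (vbasis {:A})`_i * g (vbasis {:B})`_j).

Section Lift.
Variables (A B C : falgType F) (f : 'AHom(A, C)) (g : 'AHom(B, C)).
Hypothesis fg : forall a b, f a * g b = g b * f a.

Lemma lift_fun_linear : linear (lift_fun f g).
Proof.
move=> c x y; rewrite /lift_fun scaler_sumr -big_split; apply: eq_bigr => i _ /=.
rewrite scaler_sumr -big_split; apply: eq_bigr => j _ /=.
by rewrite !mxE scalerDl scalerA.
Qed.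

HB.instance Definition _ := GRing.isLinear.Build F (tensor A B) C *:%R
  (lift_fun f g) lift_fun_linear.

Lemma lift_fun_tens a b : lift_fun f g (tens a b) = f a * g b.
Proof.
rewrite {2}(coord_vbasis (memvf a)) {2}(coord_vbasis (memvf b)).
rewrite !linear_sum mulr_suml; apply: eq_bigr => i _; rewrite mulr_sumr.
apply: eq_bigr => j _; rewrite !mxE 2!linearZ /=.
by rewrite -scalerAl -scalerAr scalerA.
Qed.

Lemma lift_fun_monoid_morphism : monoid_morphism (lift_fun f g).
Proof.
split=> [|x y]; first by rewrite -tens1 lift_fun_tens !rmorph1 mulr1.
elim/tensor_ind: x => [|x x' IH IH'|a b].
- by rewrite mul0r linear0 mul0r.
- by rewrite mulrDl !linearD /= mulrDl IH IH'.
elim/tensor_ind: y => [|y y' IH IH'|a' b'].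
- by rewrite mulr0 linear0 mulr0.
- by rewrite mulrDr !linearD /= mulrDr IH IH'.
rewrite tensM !lift_fun_tens !rmorphM /= !mulrA; congr (_ * _).
by rewrite -!mulrA fg.
Qed.

Definition tensor_lift : 'AHom(tensor A B, C) :=
  mk_ahom lift_fun_linear lift_fun_monoid_morphism.

Lemma tensor_liftE a b : tensor_lift (tens a b) = f a * g b.
Proof. by rewrite mk_ahomE lift_fun_tens. Qed.

End Lift.

Lemma eq_tensor_ahom A B C (f g : 'AHom(tensor A B, C)) :
  (forall a b, f (tens a b) = g (tens a b)) -> f =1 g.
Proof.
move=> fg; elim/tensor_ind => [|x y IH IH'|a b]; rewrite ?linear0 //.
by rewrite !linearD /= IH IH'.
Qed.

Lemma tens1r_linear A B : linear (fun a : A => tens a (1 : B)).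
Proof. by move=> c x y; rewrite tensDl tensZl. Qed.

Lemma tens1r_monoid_morphism A B : monoid_morphism (fun a : A => tens a (1 : B)).
Proof. by split=> // x y; rewrite tensM mulr1. Qed.

Definition in1 A B : 'AHom(A, tensor A B) :=
  mk_ahom (@tens1r_linear A B) (@tens1r_monoid_morphism A B).

Lemma in1E A B (a : A) : in1 A B a = tens a 1.
Proof. exact: mk_ahomE. Qed.

Lemma tens1l_linear A B : linear (fun b : B => tens (1 : A) b).
Proof. by move=> c x y; rewrite tensDr tensZr. Qed.

Lemma tens1l_monoid_morphism A B : monoid_morphism (fun b : B => tens (1 : A) b).
Proof. by split=> // x y; rewrite tensM mulr1. Qed.

Definition in2 A B : 'AHom(B, tensor A B) :=
  mk_ahom (@tens1l_linear A B) (@tens1l_monoid_morphism A B).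

Lemma in2E A B (b : B) : in2 A B b = tens 1 b.
Proof. exact: mk_ahomE. Qed.

Lemma in12 A B a b : in1 A B a * in2 A B b = tens a b.
Proof. by rewrite in1E in2E tensM mulr1 mul1r. Qed.

Lemma in21 A B a b : in2 A B b * in1 A B a = tens a b.
Proof. by rewrite in1E in2E tensM mulr1 mul1r. Qed.

Section TensorMap.
Variables (A B C D : falgType F) (f : 'AHom(A, C)) (g : 'AHom(B, D)).

Lemma tensor_map_comm a b :
  comp_ahom (in1 C D) f a * comp_ahom (in2 C D) g b =
  comp_ahom (in2 C D) g b * comp_ahom (in1 C D) f a.
Proof. by rewrite !comp_lfunE in12 in21. Qed.

Definition tensor_map : 'AHom(tensor A B, tensor C D) :=
  tensor_lift tensor_map_comm.

Lemma tensor_mapE a b : tensor_map (tens a b) = tens (f a) (g b).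
Proof. by rewrite tensor_liftE !comp_lfunE in12. Qed.

End TensorMap.

Lemma tensor_map_bij A B C D (f : 'AHom(A, C)) (g : 'AHom(B, D)) :
  bijective f -> bijective g -> bijective (tensor_map f g).
Proof.
move=> /bij_ahom_inv[f' [fK fK']] /bij_ahom_inv[g' [gK gK']].
exists (tensor_map f' g') => x.
  rewrite -comp_lfunE -[RHS]id_lfunE.
  apply: (eq_tensor_ahom (f := comp_ahom _ _) (g := id_ahom _)) => a b.
  by rewrite comp_lfunE id_lfunE !tensor_mapE fK gK.
rewrite -comp_lfunE -[RHS]id_lfunE.
apply: (eq_tensor_ahom (f := comp_ahom _ _) (g := id_ahom _)) => a b.
by rewrite comp_lfunE id_lfunE !tensor_mapE fK' gK'.
Qed.

Section TensorCA.
Variables A B C : falgType F.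

Lemma tensorCA_comm2 b c :
  in1 B (tensor A C) b * comp_ahom (in2 B (tensor A C)) (in2 A C) c =
  comp_ahom (in2 B (tensor A C)) (in2 A C) c * in1 B (tensor A C) b.
Proof. by rewrite comp_lfunE in12 in21. Qed.

Lemma tensorCA_comm1 a t :
  comp_ahom (in2 B (tensor A C)) (in1 A C) a * tensor_lift tensorCA_comm2 t =
  tensor_lift tensorCA_comm2 t * comp_ahom (in2 B (tensor A C)) (in1 A C) a.
Proof.
elim/tensor_ind: t => [|x y IH IH'|b c].
- by rewrite linear0 mulr0 mul0r.
- by rewrite linearD mulrDr mulrDl IH IH'.
rewrite tensor_liftE !comp_lfunE in12 !in2E in1E !(tensM (B := tensor A C)).
by rewrite !tensM !mulr1 !mul1r.
Qed.

(** Serves to bring a factor found in the tail of a tensor family to the front. *)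
Definition tensorCA : 'AHom(tensor A (tensor B C), tensor B (tensor A C)) :=
  tensor_lift tensorCA_comm1.

Lemma tensorCAE a b c : tensorCA (tens a (tens b c)) = tens b (tens a c).
Proof.
rewrite tensor_liftE tensor_liftE !comp_lfunE in12 in2E tensM mul1r.
by rewrite in1E in2E tensM mul1r mulr1.
Qed.

End TensorCA.

Lemma tensor_ind3 A B C (P : tensor A (tensor B C) -> Prop) :
    P 0 -> (forall x y, P x -> P y -> P (x + y)) ->
    (forall a b c, P (tens a (tens b c))) -> forall x, P x.
Proof.
move=> P0 PD Pt; elim/tensor_ind => // a; elim/tensor_ind => [|x y|b c] //.
  by rewrite tens0r.
by rewrite tensDr; apply: PD.
Qed.

Lemma eq_tensor_ahom3 A B C D (f g : 'AHom(tensor A (tensor B C), D)) :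
  (forall a b c, f (tens a (tens b c)) = g (tens a (tens b c))) -> f =1 g.
Proof.
move=> fg; elim/tensor_ind3 => [|x y IH IH'|a b c]; rewrite ?linear0 //.
by rewrite !linearD /= IH IH'.
Qed.

Lemma tensorCAK A B C : cancel (tensorCA A B C) (tensorCA B A C).
Proof.
move=> x; rewrite -comp_lfunE -[RHS]id_lfunE.
apply: (eq_tensor_ahom3 (f := comp_ahom _ _) (g := id_ahom _)) => a b c.
by rewrite comp_lfunE id_lfunE !tensorCAE.
Qed.

End TensorHomomorphisms.

(** * Augmented algebras and the Nakayama lemma *)

Section SplitLocal.
Variable F : fieldType.

Definition nilpotent_aug (A : falgType F) (e : 'AHom(A, F^o)) : Prop :=
  exists k, (lker e ^+ k = 0)%VS.

(** The working form of a local algebra split by [F]: an augmentation with nilpotent kernel passes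
    to subalgebras ([aug_inj]), quotients ([aug_surj]) and tensor products ([sl_tensor]) without
    recomputing a Jacobson radical. *)
Record splitLocal := SplitLocal {
  sl_alg :> falgType F;
  sl_aug : 'AHom(sl_alg, F^o);
  sl_nil : nilpotent_aug sl_aug }.

Definition aug (A : splitLocal) (x : A) : F := sl_aug A x.
Definition J (A : splitLocal) : {vspace A} := lker (sl_aug A).
(** The cotangent space J/J^2 is never formed; statements about it are written as memberships in
    [J2]. *)
Definition J2 (A : splitLocal) : {vspace A} := (J A * J A)%VS.

Lemma memJ (A : splitLocal) (x : A) : (x \in J A) = (aug x == 0).
Proof. by rewrite memv_ker. Qed.

Lemma augD (A : splitLocal) (x y : A) : aug (x + y) = aug x + aug y.
Proof. by rewrite /aug linearD. Qed.

Lemma augB (A : splitLocal) (x y : A) : aug (x - y) = aug x - aug y.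
Proof. by rewrite /aug linearB. Qed.

Lemma augZ (A : splitLocal) c (x : A) : aug (c *: x) = c * aug x.
Proof. by rewrite /aug linearZ. Qed.

Lemma augM (A : splitLocal) (x y : A) : aug (x * y) = aug x * aug y.
Proof. by rewrite /aug rmorphM. Qed.

Lemma aug1 (A : splitLocal) : aug (1 : A) = 1.
Proof. by rewrite /aug rmorph1. Qed.

Lemma aug_alg (A : splitLocal) c : aug (c%:A : A) = c.
Proof. by rewrite augZ aug1 mulr1. Qed.

Lemma sub_augJ (A : splitLocal) (x : A) : x - (aug x)%:A \in J A.
Proof. by rewrite memJ augB aug_alg subrr. Qed.

Lemma J_mull (A : splitLocal) (x y : A) : y \in J A -> x * y \in J A.
Proof. by rewrite !memJ augM => /eqP ->; rewrite mulr0. Qed.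

Lemma J_mulr (A : splitLocal) (x y : A) : x \in J A -> x * y \in J A.
Proof. by rewrite !memJ augM => /eqP ->; rewrite mul0r. Qed.

Lemma subvJ2 (A : splitLocal) : (J2 A <= J A)%VS.
Proof. by apply/prodvP => x y _; apply: J_mull. Qed.

Lemma subvJX (A : splitLocal) k : (J A ^+ k.+1 <= J A)%VS.
Proof. by rewrite expvSl; apply/prodvP => x y Jx _; apply: J_mulr. Qed.

Lemma memvX (A : falgType F) (U : {vspace A}) x k :
  x \in U -> x ^+ k \in (U ^+ k)%VS.
Proof.
move=> Ux; elim: k => [|k IH]; first by rewrite expr0 expv0 memv_line.
by rewrite exprS expvSl memv_mul.
Qed.

Lemma J_nilp (A : splitLocal) (x : A) : x \in J A -> exists k, x ^+ k = 0.
Proof.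
move=> /memvX Jx; have [k Jk] := sl_nil A; exists k; apply/eqP.
by rewrite -memv0 -Jk Jx.
Qed.

(** The element [x - aug x] is nilpotent, so the augmentation of its image is a nilpotent element of
    the field [F], that is, 0. *)
Lemma aug_ahom (A B : splitLocal) (f : 'AHom(A, B)) (x : A) :
  aug (f x) = aug x.
Proof.
have [k xk] := J_nilp (sub_augJ x).
have : aug (f ((x - (aug x)%:A) ^+ k)) = 0.
  by rewrite xk linear0 /aug linear0.
rewrite rmorphXn /= /aug rmorphXn /= -/(aug _) => /eqP.
rewrite (@expf_eq0 F) => /andP[_].
rewrite linearB linearZ /= rmorph1 augB aug_alg subr_eq0.
by move=> /eqP.
Qed.

Lemma J_ahom (A B : splitLocal) (f : 'AHom(A, B)) x :
  (f x \in J B) = (x \in J A).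
Proof. by rewrite !memJ aug_ahom. Qed.

Lemma limgJ (A B : splitLocal) (f : 'AHom(A, B)) : (f @: J A <= J B)%VS.
Proof. by apply/subvP => _ /memv_imgP[x Jx ->]; rewrite J_ahom. Qed.

Lemma J2_ahom (A B : splitLocal) (f : 'AHom(A, B)) x :
  x \in J2 A -> f x \in J2 B.
Proof.
move=> Jx; have : f x \in (f @: J2 A)%VS by apply: memv_img.
by apply: subvP; rewrite aimgM prodvS ?limgJ.
Qed.

(** With [S0] the part of the image in J, the modular law gives J <= S0 + J^2. This bootstraps to J
    <= S0 + J^k for all k >= 2, so nilpotence puts J inside the image, which also contains the
    scalars. *)
Lemma nakayama (A : falgType F) (B : splitLocal) (f : 'AHom(A, B)) :
  (J B <= limg f + J2 B)%VS -> forall y, exists x, f x = y.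
Proof.
move=> hJ; set S := limg f in hJ *; set S0 := (J B :&: S)%VS.
have S0P : (J B <= S0 + J2 B)%VS by rewrite vspace_modr ?subvJ2 // subv_cap subvv.
have S0S : (S0 * S0 <= S0)%VS.
  apply/prodvP => x y /memv_capP[Jx Sx] /memv_capP[Jy Sy].
  rewrite memv_cap J_mulr //=.
  move: Sx Sy => /memv_imgP[x' _ ->] /memv_imgP[y' _ ->].
  by rewrite -rmorphM memv_img ?memvf.
(* The induction hypothesis is substituted for both factors of J * J: [S0 * S0] stays in [S0], and
   every other product lies in J^(k+3). *)
have key k : (J B <= S0 + J B ^+ k.+2)%VS.
  elim: k => [//|k IH]; apply: subv_trans S0P _; rewrite subv_add addvSl /=.
  apply: subv_trans (prodvS IH IH) _.
  rewrite prodvDl !prodvDr !subv_add (subv_trans S0S (addvSl _ _)) /=.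
  have S0J : (S0 <= J B)%VS by apply: capvSl.
  have h (U : {vspace B}) : (U <= J B ^+ k.+3 -> U <= S0 + J B ^+ k.+3)%VS.
    by move=> /subv_trans; apply; apply: addvSr.
  rewrite !h //.
  - by rewrite [X in (_ <= X)%VS]expvSr prodvSr ?subvJX.
  - by rewrite [X in (_ <= X)%VS]expvSr prodvSr.
  - by rewrite [X in (_ <= X)%VS]expvSl prodvSl.
have JS : (J B <= S)%VS.
  have [k Jk] := sl_nil B; have := key k.
  rewrite -[k.+2]addn2 expvD [(J B ^+ k)%VS]Jk prod0v addv0 => /subv_trans; apply.
  exact: capvSr.
move=> y; suff /memv_imgP[x _ ->] : y \in S by exists x.
rewrite -(subrK ((aug y)%:A) y) memvD //; first by rewrite (subvP JS) ?sub_augJ.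
by rewrite memvZ // -(rmorph1 f); apply: memv_img (memvf _).
Qed.

Lemma surj_of_cotangent (A B : splitLocal) (f : 'AHom(A, B)) :
    (forall y, y \in J B -> exists x, y - f x \in J2 B) ->
  forall y, exists x, f x = y.
Proof.
move=> h; apply: nakayama; apply/subvP => y /h[x yx].
by rewrite -(subrK (f x) y) addrC memv_add // memv_img ?memvf.
Qed.

(** The augmentation of [B] is restricted along [f]; the powers of its kernel embed into those of
    [J B]. *)
Lemma aug_inj (A : falgType F) (B : splitLocal) (f : 'AHom(A, B)) :
  injective f -> exists e : 'AHom(A, F^o), nilpotent_aug e.
Proof.
move=> injf; exists (comp_ahom (sl_aug B) f); have [k Jk] := sl_nil B.
exists k; apply/eqP; rewrite -subv0 -(limg_ker0 _ _ (introT lker0P injf)).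
rewrite limg0 aimgX -Jk expvS //; apply/subvP => _ /memv_imgP[x Jx ->].
by move: Jx; rewrite !memv_ker comp_lfunE.
Qed.

(** The augmentation of [A] descends to [B], whatever preimages are chosen, because it vanishes on
    the kernel of [f]: if [f x = 0], the nilpotent element [x - aug x] maps to the scalar [- aug x],
    which must then be 0. *)
Lemma aug_surj (A : splitLocal) (B : falgType F) (f : 'AHom(A, B)) :
  (forall y, exists x, f x = y) -> exists e : 'AHom(B, F^o), nilpotent_aug e.
Proof.
move=> sf; pose g y : F^o := aug (projT1 (cid (sf y))).
have ker0 x : f x = 0 -> aug x = 0.
  move=> fx0; apply: contraNeq (oner_neq0 B) => nz.
  have [k xk] := J_nilp (sub_augJ x).
  have := congr1 f xk; rewrite linear0 rmorphXn /= linearB /= fx0 sub0r.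
  rewrite linearZ /= rmorph1 -scaleNr exprZn expr1n => /eqP.
  by rewrite scaler_eq0 expf_eq0 oppr_eq0 (negPf nz) andbF.
have gE x : g (f x) = aug x.
  rewrite /g; case: cid => z /= zE; apply/eqP; rewrite -subr_eq0 -augB.
  by rewrite ker0 ?linearB /= ?zE ?subrr.
have lg : linear g.
  move=> c x y; have [x' <-] := sf x; have [y' <-] := sf y.
  by rewrite -linearP !gE augD augZ.
have mg : monoid_morphism g.
  split=> [|x y]; first by rewrite -(rmorph1 f) gE aug1.
  by have [x' <-] := sf x; have [y' <-] := sf y; rewrite -rmorphM !gE augM.
exists (mk_ahom lg mg); have [k Jk] := sl_nil A; exists k.
apply/eqP; rewrite -subv0 -(limg0 f) -Jk aimgX expvS //.
apply/subvP => y; have [x <-] := sf y; rewrite memv_ker mk_ahomE gE -memJ.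
exact: memv_img.
Qed.

End SplitLocal.

(** * Tensor products of augmented algebras and their cotangent spaces *)

Section SplitLocalTensor.
Variable F : fieldType.

Lemma alg_linear (A : falgType F) : linear (fun c : F^o => (c : F)%:A : A).
Proof. by move=> c x y; rewrite scalerDl scalerA. Qed.

Lemma alg_monoid_morphism (A : falgType F) :
  monoid_morphism (fun c : F^o => (c : F)%:A : A).
Proof.
by split=> [|x y]; rewrite ?scale1r // -scalerAl mul1r scalerA.
Qed.

Definition unit_ahom (A : falgType F) : 'AHom(F^o, A) :=
  mk_ahom (@alg_linear A) (@alg_monoid_morphism A).

Definition const_ahom (A : splitLocal F) (B : falgType F) : 'AHom(A, B) :=
  comp_ahom (unit_ahom B) (sl_aug A).

Lemma const_ahomE (A : splitLocal F) (B : falgType F) x :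
  const_ahom A B x = (aug x)%:A.
Proof. by rewrite comp_lfunE mk_ahomE. Qed.

Section Projections.
Variables A B : splitLocal F.

Lemma pr1_comm a b :
  id_ahom A a * const_ahom B A b = const_ahom B A b * id_ahom A a.
Proof. by rewrite const_ahomE -scalerAl -scalerAr mulr1 mul1r. Qed.

(** The identity of [A] tensored with the augmentation of [B]; it retracts [in1]. *)
Definition pr1 : 'AHom(tensor A B, A) := tensor_lift pr1_comm.

Lemma pr1E a b : pr1 (tens a b) = aug b *: a.
Proof. by rewrite tensor_liftE id_lfunE const_ahomE -scalerAr mulr1. Qed.

Lemma pr2_comm a b :
  const_ahom A B a * id_ahom B b = id_ahom B b * const_ahom A B a.
Proof. by rewrite const_ahomE -scalerAl -scalerAr mulr1 mul1r. Qed.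

Definition pr2 : 'AHom(tensor A B, B) := tensor_lift pr2_comm.

Lemma pr2E a b : pr2 (tens a b) = aug a *: b.
Proof. by rewrite tensor_liftE id_lfunE const_ahomE -scalerAl mul1r. Qed.

Definition tensor_aug : 'AHom(tensor A B, F^o) := comp_ahom (sl_aug A) pr1.

Lemma tensor_augE a b : tensor_aug (tens a b) = aug a * aug b.
Proof. by rewrite comp_lfunE pr1E linearZ /= [LHS]mulrC. Qed.

(** If J_A^k = 0 and J_B^l = 0, the k-th power of the kernel lies in the kernel of [pr1], hence in
    [N * T] with [N] the copy of J_B. As [T * N <= N * T], the l-th power of [N * T] lies in N^l T =
    0, which gives the exponent k l. *)
Lemma tensor_aug_nilpotent : nilpotent_aug tensor_aug.
Proof.
pose N := (in2 A B @: J B)%VS; pose T := {: tensor A B}%VS.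
have TN : (T * N <= N * T)%VS.
  apply/prodvP => t n _ /memv_imgP[c Jc ->].
  elim/tensor_ind: t => [|x y IH IH'|a b].
  - by rewrite mul0r mem0v.
  - by rewrite mulrDl memvD.
  rewrite in2E tensM mulr1 -in21 memv_mul ?memvf //.
  exact/memv_img/J_mull.
have TNX k : (T * N ^+ k <= N ^+ k * T)%VS.
  elim: k => [|k IH]; first by rewrite expv0 prodv1 prod1v.
  rewrite expvSr prodvA; apply: subv_trans (prodvSl _ IH) _.
  by rewrite -!prodvA; apply: prodvSr.
have NTX k : ((N * T) ^+ k <= N ^+ k * T)%VS.
  elim: k => [|k IH]; first by rewrite !expv0 prod1v subvf.
  rewrite !expvSl -!prodvA prodvSr //; apply: subv_trans (prodvSr _ IH) _.
  rewrite prodvA; apply: subv_trans (prodvSl _ (TNX k)) _.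
  by rewrite -prodvA prodvSr // subvf.
have kerN : (lker pr1 <= N * T)%VS.
  have h t : t - in1 A B (pr1 t) \in (N * T)%VS.
    elim/tensor_ind: t => [|x y IH IH'|a b].
    - by rewrite (linear0 pr1) (linear0 (in1 A B)) subrr mem0v.
    - by rewrite (linearD pr1) (linearD (in1 A B)) opprD addrACA memvD.
    rewrite pr1E in1E tensZl -tensZr -scaleN1r -tensZr -tensDr scaleN1r.
    by rewrite -in21 memv_mul ?memvf // memv_img ?sub_augJ.
  apply/subvP => t; rewrite memv_ker => /eqP E.
  by have := h t; rewrite E (linear0 (in1 A B)) subr0.
have [k Jk] := sl_nil A; have [l Jl] := sl_nil B; exists (k * l)%N.
apply/eqP; rewrite -subv0 expvM.
have -> : 0%VS = (N ^+ l * T)%VS by rewrite -aimgX [(J B ^+ l)%VS]Jl limg0 prod0v.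
apply: subv_trans (NTX l); apply/expvS/(subv_trans _ kerN); rewrite lkerE.
rewrite -subv0 aimgX -Jk expvS //; apply/subvP => _ /memv_imgP[x Jx ->].
by move: Jx; rewrite !memv_ker comp_lfunE.
Qed.

Definition sl_tensor : splitLocal F := SplitLocal tensor_aug_nilpotent.

Lemma aug_tens a b : @aug F sl_tensor (tens a b) = aug a * aug b.
Proof. exact: tensor_augE. Qed.

(** The cotangent space of a tensor product is the sum of those of the factors, the two projections
    giving the components. *)
Lemma tensor_cotangent (t : sl_tensor) :
  t \in J sl_tensor -> t - in1 A B (pr1 t) - in2 A B (pr2 t) \in J2 sl_tensor.
Proof.
(* Restoring the constant term gives a statement about all [s] that can be checked on pure tensors,
   where the expression is the product of [a - aug a] and [b - aug b], both in J. *)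
suff h (s : sl_tensor) :
    s - in1 A B (pr1 s) - in2 A B (pr2 s) + (aug s)%:A \in J2 sl_tensor.
  by rewrite memJ => /eqP E; have := h t; rewrite E scale0r addr0.
elim/tensor_ind: s => [|x y IH IH'|a b].
- by rewrite /aug !linear0 scale0r !addr0 mem0v.
- rewrite augD (linearD pr1) (linearD pr2) (linearD (in1 A B)).
  rewrite (linearD (in2 A B)) scalerDl.
  suff E (u u' v v' w w' z z' : sl_tensor) :
    u + u' - (v + v') - (w + w') + (z + z') =
    (u - v - w + z) + (u' - v' - w' + z') by rewrite E memvD.
  by rewrite !opprD (addrACA u) (addrACA (u - v)) (addrACA (u - v - w)).
rewrite pr1E pr2E in1E in2E aug_tens.
suff -> : tens a b - tens (aug b *: a) 1 - tens 1 (aug a *: b)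
    + (aug a * aug b)%:A =
  in1 A B (a - (aug a)%:A) * in2 A B (b - (aug b)%:A) :> sl_tensor.
  by rewrite memv_mul // -[J sl_tensor]/(J _) (J_ahom (B := sl_tensor)) sub_augJ.
rewrite in12.
have E (x y : A) (z w : B) : tens (x - y) (z - w) =
    tens x z - tens x w - tens y z + tens y w.
  rewrite -scaleN1r -[- w]scaleN1r tensDl !tensDr !tensZl !tensZr !scaleN1r.
  by rewrite opprK addrA.
by rewrite E !tensZl !tensZr scalerA tens1 mulrC.
Qed.

End Projections.
Section TensorMapProjections.
Variables (A B C D : splitLocal F) (f : 'AHom(A, C)) (g : 'AHom(B, D)).

Lemma pr1_map t : pr1 C D (tensor_map f g t) = f (pr1 A B t).
Proof.
rewrite -!comp_lfunE.
apply: (eq_tensor_ahom (f := comp_ahom _ _) (g := comp_ahom _ _)) => a b.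
by rewrite !comp_lfunE tensor_mapE !pr1E linearZ /= aug_ahom.
Qed.

Lemma pr2_map t : pr2 C D (tensor_map f g t) = g (pr2 A B t).
Proof.
rewrite -!comp_lfunE.
apply: (eq_tensor_ahom (f := comp_ahom _ _) (g := comp_ahom _ _)) => a b.
by rewrite !comp_lfunE tensor_mapE !pr2E linearZ /= aug_ahom.
Qed.

End TensorMapProjections.

Section InclusionsProjections.
Variables A B : splitLocal F.

Lemma pr1_in1 a : pr1 A B (in1 A B a) = a.
Proof. by rewrite in1E pr1E aug1 scale1r. Qed.

Lemma pr2_in2 b : pr2 A B (in2 A B b) = b.
Proof. by rewrite in2E pr2E aug1 scale1r. Qed.

Lemma pr2_in1 a : pr2 A B (in1 A B a) = (aug a)%:A.
Proof. by rewrite in1E pr2E. Qed.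

End InclusionsProjections.

End SplitLocalTensor.

(** * Normal homomorphisms and Fitting's lemma *)

Section NormalHomomorphisms.
Variable F : fieldType.
Implicit Types A B C : falgType F.

(* The analogue, for algebras, of a group homomorphism with normal image. *)
Definition normal_ahom A B (f : 'AHom(A, B)) : Prop :=
  (limg f * 'C(limg f) = {:B})%VS.

Lemma normal_surj A B (f : 'AHom(A, B)) :
  (forall y, exists x, f x = y) -> normal_ahom f.
Proof.
move=> sf; apply/eqP; rewrite eqEsubv subvf /=; apply/subvP => y _.
by rewrite -[y]mulr1 memv_mul ?centv1 // (surj_limg sf) memvf.
Qed.

Lemma normal_bij A B (f : 'AHom(A, B)) : bijective f -> normal_ahom f.
Proof. by case=> g _ gK; apply: normal_surj => y; exists (g y). Qed.

(** The image under [g] of the centraliser of [limg f], and the centraliser of [limg g], both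
    centralise the image of the composite; together with that image they span [C]. *)
Lemma normal_comp A B C (f : 'AHom(A, B)) (g : 'AHom(B, C)) :
  normal_ahom f -> normal_ahom g -> normal_ahom (comp_ahom g f).
Proof.
move=> nf ng; apply/eqP; rewrite eqEsubv subvf /= -{1}ng -{1}nf aimgM limg_comp.
rewrite -prodvA prodvSr //.
apply/prodvP => _ y /memv_imgP[c /centvP Cc ->] /centvP Cy.
apply/centvP => _ /memv_imgP[x fx ->]; have gm z : g z \in limg g.
  exact/memv_img/memvf.
by rewrite -mulrA Cy ?gm // !mulrA -!rmorphM /= Cc.
Qed.

Lemma normal_in1 A B : normal_ahom (in1 A B).
Proof.
apply/eqP; rewrite eqEsubv subvf /=; apply/subvP => t _.
elim/tensor_ind: t => [|x y|a b]; [exact: mem0v | exact: memvD |].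
rewrite -in12 memv_mul ?memv_img ?memvf //; apply/centvP => _ /memv_imgP[x _ ->].
by rewrite in12 in21.
Qed.

Lemma normal_in2 A B : normal_ahom (in2 A B).
Proof.
apply/eqP; rewrite eqEsubv subvf /=; apply/subvP => t _.
elim/tensor_ind: t => [|x y|a b]; [exact: mem0v | exact: memvD |].
rewrite -in21 memv_mul ?memv_img ?memvf //; apply/centvP => _ /memv_imgP[x _ ->].
by rewrite in12 in21.
Qed.

Fixpoint pow_ahom A (f : 'AHom(A, A)) n : 'AHom(A, A) :=
  if n is m.+1 then comp_ahom f (pow_ahom f m) else id_ahom A.

Lemma pow_ahomE A (f : 'AHom(A, A)) n x : pow_ahom f n x = iter n f x.
Proof.
elim: n => [|n IH] /=; first by rewrite id_lfunE.
by rewrite comp_lfunE IH.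
Qed.

Lemma normal_pow A (f : 'AHom(A, A)) n :
  normal_ahom f -> normal_ahom (pow_ahom f n).
Proof.
move=> nf; elim: n => [|n IH]; last exact: normal_comp.
by apply: normal_bij; exists id => x; rewrite /= id_lfunE.
Qed.

(** The exponent is one for which the image of f^n has least dimension. *)
Lemma stable_image A (f : 'AHom(A, A)) :
  exists n, forall i x, exists z, iter n f x = iter (n + i) f z.
Proof.
pose Q d := `[< exists n, \dim (limg (pow_ahom f n)) = d >].
have Q0 : exists d, Q d.
  by exists (\dim (limg (pow_ahom f 0))); apply/asboolP; exists 0.
have [d /asboolP[n dn] dmin] := ex_minnP Q0.
exists n => i x.
suff : pow_ahom f n x \in limg (pow_ahom f (n + i)).
  by move=> /memv_imgP[z _]; rewrite !pow_ahomE; exists z.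
have sub : (limg (pow_ahom f (n + i)) <= limg (pow_ahom f n))%VS.
  apply/subvP => _ /memv_imgP[z _ ->]; rewrite pow_ahomE iterD -!pow_ahomE.
  exact/memv_img/memvf.
have/eqP -> : limg (pow_ahom f (n + i)) == limg (pow_ahom f n).
  by rewrite eqEdim sub dn dmin //; apply/asboolP; exists (n + i)%N.
exact/memv_img/memvf.
Qed.

(** The geometric sum inverts 1 - f up to f^n. It solves equations modulo J^2 for the map v = 1 -
    u. *)
Lemma telescope_iter A (f : 'AHom(A, A)) n x :
  \sum_(k < n) iter k f x - f (\sum_(k < n) iter k f x) = x - iter n f x.
Proof.
rewrite linear_sum; elim: n => [|n IH]; first by rewrite !big_ord0 !subrr.
by rewrite !big_ord_recr /= opprD addrACA IH addrA subrK.
Qed.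

Lemma quotient_exists A (I : {vspace A}) : proper_ideal I ->
  exists (B : falgType F) (p : 'AHom(A, B)),
    (forall y, exists x, p x = y) /\ lker p = I.
Proof.
move=> idI; exists (quotient_alg idI).
exists (mk_ahom (quotient_pi_linear idI)
                (quotient_pi_monoid_morphism idI)).
split=> [y|].
  by have [x <-] := quotient_pi_surj y; exists x; rewrite mk_ahomE.
by apply/vspaceP => x; rewrite memv_ker mk_ahomE quotient_pi_eq0.
Qed.

Lemma sl_quotient (A : splitLocal F) (I : {vspace A}) : proper_ideal I ->
  exists (B : splitLocal F) (p : 'AHom(A, B)),
    (forall y, exists x, p x = y) /\ lker p = I.
Proof.
move=> /quotient_exists[B [p [sp kp]]]; have [e ne] := aug_surj sp.
by exists (SplitLocal ne), p.
Qed.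

Lemma lker_proper A B (f : 'AHom(A, B)) : proper_ideal (lker f).
Proof.
split; last by rewrite memv_ker rmorph1 oner_neq0.
  apply/prodvP => x y _; rewrite !memv_ker => /eqP fy.
  by rewrite rmorphM /= fy mulr0.
apply/prodvP => x y; rewrite !memv_ker => /eqP fx _.
by rewrite rmorphM /= fx mul0r.
Qed.

Lemma dim_surj A B (f : 'AHom(A, B)) : (forall y, exists x, f x = y) ->
  (\dim (lker f) + \dim {:B} = \dim {:A})%N.
Proof. by move=> sf; rewrite -(limg_ker_dim f fullv) capfv (surj_limg sf). Qed.

(** Stability on the left is where normality enters: [P] is the product of the image of [f] and its
    centraliser; the centraliser commutes with f(J), and the image maps f(J) to itself. The ideal is
    proper since it lies in [J P]. *)
Lemma normal_ideal (A P : splitLocal F) (f : 'AHom(A, P)) :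
  normal_ahom f -> proper_ideal (f @: J A * {:P})%VS.
Proof.
move=> nf; set M := (f @: J A)%VS; split.
- rewrite -[X in (X * _)%VS]nf -prodvA (prodvA 'C(_)%VS).
  have CM : ('C(limg f) * M <= M * {:P})%VS.
    apply/prodvP => c _ /centvP Cc /memv_imgP[x Jx ->].
    by rewrite Cc ?memv_mul ?memvf ?memv_img ?memvf.
  apply: subv_trans (prodvSr _ (prodvSl _ CM)) _; rewrite !prodvA -prodvA.
  apply: prodvS; last exact: subvf.
  rewrite -aimgM limgS //; apply/prodvP => x y _; exact: J_mull.
- by rewrite -prodvA prodvSr ?subvf.
have : (M * {:P} <= J P)%VS.
  apply/prodvP => x y xM _; apply: J_mulr; exact: (subvP (limgJ f)).
by move=> /subvP h; apply/negP => /h; rewrite memJ aug1 oner_eq0.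
Qed.

(* Nakayama: a complement of the ideal generated by the image of the maximal
   ideal generates P as a left module over the image of f. *)
Lemma normal_dim (A P : splitLocal F) (f : 'AHom(A, P)) :
  (\dim {:P} <= \dim (limg f) * (\dim {:P} - \dim (f @: J A * {:P})))%N.
Proof.
set M := (f @: J A)%VS; set D := (M * {:P})%VS; set S := limg f.
rewrite -dimv_compl; apply: leq_trans (dim_prodv _ _); apply: dimvS.
have MS k : (M ^+ k <= S)%VS by rewrite -aimgX limgS ?subvf.
(* Iterates P = D^C + M P. The coefficients M^k stay in [S], and the remainder vanishes once M^k =
   0. *)
have key k : ({:P} <= S * D^C + M ^+ k * {:P})%VS.
  elim: k => [|k IH]; first by rewrite expv0 prod1v addvSr.
  apply: subv_trans IH _; rewrite subv_add addvSl /=.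
  rewrite -[X in (_ * X)%VS](addv_complf D).
  rewrite prodvDr subv_add; apply/andP; split; last first.
    by apply: subv_trans (addvSl _ _); apply: prodvSl.
  by rewrite /D prodvA -expvSr addvSr.
have [k Jk] := sl_nil P; have := key k.
have -> : (M ^+ k = 0)%VS.
  by apply/eqP; rewrite -subv0 -Jk expvS // limgJ.
by rewrite prod0v addv0.
Qed.

End NormalHomomorphisms.

(** * A Fitting decomposition as a tensor factorization *)

Section Fitting.
Variables (F : fieldType) (P X Y : splitLocal F).
Variables (f : 'AHom(P, tensor X Y)) (g : 'AHom(X, P)) (h : 'AHom(Y, P)).
Variables (u v : 'AHom(P, P)).
Hypothesis uE : forall x, u x = g (pr1 X Y (f x)).
Hypothesis vE : forall x, v x = h (pr2 X Y (f x)).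
Hypothesis nu : normal_ahom u.
Hypothesis uv : forall x, x \in J P -> x - u x - v x \in J2 P.

(** [B] is P modulo ker u^n and [C] is P modulo the ideal generated by u^n(J). On cotangent spaces
    these are the parts where u is invertible and nilpotent, as in the linear Fitting lemma. *)
Lemma fitting_factor : exists n (B C : falgType F) (p : 'AHom(P, B)),
  [/\ forall y, exists x, p x = y,
      lker p = lker (pow_ahom u n),
      forall i x, exists z, iter n u x = iter (n + i) u z
    & alg_iso P (tensor B C)].
Proof.
have [n stab] := stable_image u; exists n.
set w := pow_ahom u n.
have [B [p [sp kp]]] := sl_quotient (lker_proper w).
have [C [q [sq kq]]] := sl_quotient (normal_ideal (normal_pow n nu)).
exists B, C, p; split=> //; apply/alg_isoP.
pose psi := comp_ahom (tensor_map (comp_ahom p g) (comp_ahom q h)) f.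
(* The dimension count: [normal_dim] bounds dim P by dim u^n(P) times the dimension of [C], and dim
   u^n(P) = dim B. *)
exists psi; apply: surj_bij_lfun; last first.
  rewrite dim_tensor; apply: leq_trans (normal_dim w) _.
  have EB := dim_surj sp; rewrite kp in EB.
  have EC := dim_surj sq; rewrite kq in EC.
  have Ew : (\dim (lker w) + \dim (limg w) = \dim {:P})%N.
    by rewrite -(limg_ker_dim w fullv) capfv.
  by rewrite -EC addKn; move: Ew; rewrite -EB => /addnI ->.
pose T := sl_tensor B C; pose psiT : 'AHom(P, T) := psi.
have pr1psi x : pr1 B C (psi x) = p (u x).
  by rewrite comp_lfunE pr1_map comp_lfunE uE.
have pr2psi x : pr2 B C (psi x) = q (v x).
  by rewrite comp_lfunE pr2_map comp_lfunE vE.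
have iterJ m x : x \in J P -> iter m u x \in J P.
  by move=> Jx; elim: m => //= m; rewrite J_ahom.
have q0 x : x \in J P -> q (iter n u x) = 0.
  move=> Jx; apply/eqP; rewrite -memv_ker kq -[X in X \in _]mulr1.
  by rewrite memv_mul ?memvf // -pow_ahomE memv_img.
have psiE x : x \in J P ->
    psi x - in1 B C (p (u x)) - in2 B C (q (v x)) \in J2 T.
  move=> Jx; rewrite -pr1psi -pr2psi; apply: (@tensor_cotangent F B C).
  by rewrite (J_ahom psiT).
(* Take z with u^n x = u^(2n+1) z and y = u^n z. Then u y - x lies in ker u^n, so the first
   component of [psi y] is [p x]; the second is q(y - u y) = 0 modulo J^2, as [q] kills u^n(J). *)
have surj1 x : x \in J P -> exists z, in1 B C (p x) - psi z \in J2 T.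
  move=> Jx; have [z xz] := stab n.+1 x.
  have Jz : z \in J P.
    have := congr1 (@aug F P) xz; rewrite -!pow_ahomE !aug_ahom => E.
    by rewrite memJ -E -memJ.
  exists (iter n u z); have Jy := iterJ n z Jz; have := psiE _ Jy.
  have -> : p (u (iter n u z)) = p x.
    apply/eqP; rewrite -subr_eq0 -linearB -memv_ker kp memv_ker linearB /=.
    by rewrite !pow_ahomE -iterS -iterD -xz subrr.
  have qv : q (v (iter n u z)) \in J2 C.
    have := J2_ahom q (uv Jy); rewrite !linearB /= q0 //.
    rewrite -iterS iterSr q0 ?J_ahom //.
    by rewrite subr0 sub0r memvN.
  move=> h1; rewrite -memvN opprB.
  rewrite -[X in X \in _](subrK (in2 B C (q (v (iter n u z))))).
  by rewrite memvD // (J2_ahom (B := T)).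
(* For the geometric sum y, v y is x - u^n x modulo J^2, so the second component of [psi y] is [q x]
   modulo J^2; [surj1] supplies a correction for the first component p(u y). *)
have surj2 x : x \in J P -> exists z, in2 B C (q x) - psi z \in J2 T.
  move=> Jx; pose y := \sum_(k < n) iter k u x.
  have Jy : y \in J P by apply: memv_suml => k _; apply: iterJ.
  have Euy : y - u y = x - iter n u x by apply: telescope_iter.
  have qv : q x - q (v y) \in J2 C.
    have := J2_ahom q (uv Jy); rewrite Euy !linearB /= q0 //.
    by rewrite subr0.
  have [z zE] := surj1 (u y) (etrans (J_ahom u y) Jy).
  exists (y - z); have := psiE _ Jy.
  set a := in1 _ _ _ in zE *; move=> h1.
  have h2 : in2 B C (q x - q (v y)) \in J2 T by rewrite (J2_ahom (B := T)).
  have -> : in2 B C (q x) - psi (y - z) = in2 B C (q x - q (v y))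
     - (psi y - a - in2 B C (q (v y))) - (a - psi z).
    rewrite (linearB psi) (linearB (in2 B C)) !opprB.
    set b := in2 _ _ _; set c := in2 _ _ _.
    rewrite !addrA subrK [b + a]addrC -!addrA [RHS]addrC -!addrA addNr addr0.
    by rewrite [psi z - _]addrC.
  by apply: memvB => //; apply: memvB.
apply: (@surj_of_cotangent F P T psiT) => t Jt.
have [x px] := sp (pr1 B C t); have [y qy] := sq (pr2 B C t).
have Jx : x \in J P by rewrite -(J_ahom p) px (@J_ahom F T B).
have Jy : y \in J P by rewrite -(J_ahom q) qy (@J_ahom F T C).
have [x' xE] := surj1 x Jx; have [y' yE] := surj2 y Jy.
exists (x' + y'); have := @tensor_cotangent F B C t Jt; rewrite -px -qy => h1.
have -> : t - psi (x' + y') = (t - in1 B C (p x) - in2 B C (q y))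
   + (in1 B C (p x) - psi x') + (in2 B C (q y) - psi y').
  set a := in1 _ _ _; set b := in2 _ _ _.
  rewrite (linearD psi) opprD addrA [t - a - b]addrAC !addrA subrK.
  by rewrite (addrAC (t - b)) subrK.
by apply: memvD => //; apply: memvD.
Qed.

End Fitting.

(** * Irreducible algebras: Fitting dichotomy and exchange of factors *)

Section Irreducible.
Variable F : fieldType.

Lemma alg_iso_refl (A : falgType F) : alg_iso A A.
Proof.
by apply/alg_isoP; exists (id_ahom A); exists id => x; rewrite /= id_lfunE.
Qed.

Lemma irreducible_iso (A B : falgType F) :
  alg_iso A B -> irreducible_algebra A -> irreducible_algebra B.
Proof.
move=> AB [ntA irrA]; split=> [tB|C [D BCD]].
  exact/ntA/(alg_iso_trans AB).
have [|C1|CA] := irrA C; first by exists D; apply: alg_iso_trans AB BCD.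
  by left.
by right; apply: alg_iso_trans CA AB.
Qed.

Lemma irreducible_dim (A : falgType F) :
  irreducible_algebra A -> (1 < \dim {:A})%N.
Proof.
move=> [ntA _]; rewrite ltn_neqAle eq_sym dim_gt0 andbT.
apply/eqP => dA; apply/ntA/alg_iso_sym/alg_isoP; exists (unit_ahom A).
apply: inj_bij_lfun; last by rewrite dA dim_gt0.
move=> c d; rewrite !mk_ahomE => /eqP; rewrite -subr_eq0 -scalerBl scaler_eq0.
by rewrite oner_eq0 orbF subr_eq0 => /eqP.
Qed.

Lemma dim_aug (A : splitLocal F) :
  (forall x : A, x = (aug x)%:A) -> \dim {:A} = 1%N.
Proof.
move=> h; have/vspaceP -> : {:A}%VS =i 1%VS.
  by move=> x; rewrite memvf; apply/esym/vlineP; exists (aug x).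
exact: dimv1.
Qed.

(** By irreducibility the factor [B] of [fitting_factor] is [F] or [P]. In the first case u^n has
    one-dimensional image, the scalars; in the second u^n is injective, and stability of its image
    makes u surjective. *)
Lemma fitting (P X Y : splitLocal F)
    (f : 'AHom(P, tensor X Y)) (g : 'AHom(X, P)) (h : 'AHom(Y, P))
    (u v : 'AHom(P, P)) :
    (forall x, u x = g (pr1 X Y (f x))) ->
    (forall x, v x = h (pr2 X Y (f x))) ->
    normal_ahom u -> (forall x, x \in J P -> x - u x - v x \in J2 P) ->
    irreducible_algebra P ->
  bijective u \/ exists n, forall x, iter n u x = (aug x)%:A.
Proof.
move=> uE vE nu uv [ntP irrP].
have [n [B [C [p [sp kp stab PBC]]]]] := fitting_factor uE vE nu uv.
have dB := dim_surj sp; rewrite kp in dB.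
have [|B1|BP] := irrP B; first by exists C.
- right; exists n => x.
  have d1 : \dim (limg (pow_ahom u n)) = 1%N.
    rewrite (dim_alg_iso B1) dim_regular in dB.
    by have := limg_ker_dim (pow_ahom u n) fullv; rewrite capfv -dB => /addnI.
  have : pow_ahom u n x \in 1%VS.
    suff /eqP -> : 1%VS == limg (pow_ahom u n) by rewrite memv_img ?memvf.
    rewrite eqEdim d1 dimv1 leqnn andbT -memvE -(rmorph1 (pow_ahom u n)).
    by rewrite memv_img ?memvf.
  move=> /vlineP[c E]; have := congr1 (@aug F P) E.
  by rewrite aug_alg aug_ahom -pow_ahomE E => ->.
left; have injn : injective (pow_ahom u n).
  apply/lker0P; rewrite -dimv_eq0; move/eqP: dB.
  by rewrite (dim_alg_iso BP) -[X in _ == X]add0n eqn_add2r.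
apply: surj_bij_lfun => // x; have [z] := stab 1%N x.
by rewrite addn1 iterSr -!pow_ahomE => /injn ->; exists z.
Qed.

Lemma dichotomy (P Q R : splitLocal F)
    (f : 'AHom(P, tensor Q R)) (g : 'AHom(tensor Q R, P)) :
    irreducible_algebra P -> normal_ahom f -> normal_ahom g ->
    bijective (comp_ahom g f) ->
  bijective (fun x => g (in1 Q R (pr1 Q R (f x)))) \/
  bijective (fun x => g (in2 Q R (pr2 Q R (f x)))).
Proof.
(* Precomposing with the inverse [w] of [g f] normalises the composite to the identity, so that u +
   v = 1 on J/J^2; [conjug] removes [w] at the end. *)
move=> irrP nf ng bgf; have [w [gfK wK]] := bij_ahom_inv bgf.
have bw : bijective w by exists (comp_ahom g f).
pose f' := comp_ahom f w.
pose u := comp_ahom (comp_ahom g (in1 Q R)) (comp_ahom (pr1 Q R) f').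
pose v := comp_ahom (comp_ahom g (in2 Q R)) (comp_ahom (pr2 Q R) f').
have nu : normal_ahom u.
  apply: normal_comp; apply: normal_comp => //.
  - exact: normal_comp (normal_bij bw) nf.
  - by apply: normal_surj => y; exists (in1 Q R y); rewrite pr1_in1.
  - exact: normal_in1.
have uE x : u x = comp_ahom g (in1 Q R) (pr1 Q R (f' x)) by rewrite !comp_lfunE.
have vE x : v x = comp_ahom g (in2 Q R) (pr2 Q R (f' x)) by rewrite !comp_lfunE.
have uv x : x \in J P -> x - u x - v x \in J2 P.
  move=> Jx; rewrite -{1}[x]wK !comp_lfunE -/(f' x).
  have Jf : f' x \in J (sl_tensor Q R) by rewrite (@J_ahom F P (sl_tensor Q R)).
  have := @J2_ahom F (sl_tensor Q R) P g _ (tensor_cotangent Jf).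
  by rewrite !(linearB g) !comp_lfunE.
have conjug (a : 'AHom(P, P)) (b : P -> P) :
    (forall x, a x = b (w x)) -> bijective a -> bijective b.
  move=> ab ba; apply: (eq_bij (bij_comp ba bgf)) => x /=.
  by rewrite ab gfK.
have [bu|[n un]] := fitting uE vE nu uv irrP; [left|right].
  by apply: conjug bu => x; rewrite !comp_lfunE.
apply: (conjug v) => [x|]; first by rewrite !comp_lfunE.
apply: surj_bij_lfun => //; apply: surj_of_cotangent => x Jx.
(* Here u^n kills J, so y - u y = x and v y agrees with x modulo J^2. *)
pose y := \sum_(k < n) iter k u x; exists y.
have Jy : y \in J P.
  by apply: memv_suml => k _; elim: (k : nat) => [|m IH] //; rewrite iterS J_ahom.
have := uv y Jy; rewrite telescope_iter un.
by move: Jx; rewrite memJ => /eqP ->; rewrite scale0r subr0.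
Qed.

(** Fitting's lemma on [Q], applied to [a b], shows that [a] is bijective. The complements then have
    equal dimension, and the projection R -> P' is surjective on J/J^2. *)
Lemma exchange (P P' Q R : splitLocal F)
    (f : 'AHom(tensor P P', tensor Q R)) (f' : 'AHom(tensor Q R, tensor P P'))
    (a : 'AHom(P, Q)) (b : 'AHom(Q, P)) :
    cancel f f' -> cancel f' f ->
    irreducible_algebra P -> irreducible_algebra Q ->
    (forall x, a x = pr1 Q R (f (in1 P P' x))) ->
    (forall x, b x = pr1 P P' (f' (in1 Q R x))) ->
    bijective (fun x => b (a x)) ->
  alg_iso P Q /\ alg_iso P' R.
Proof.
move=> fK f'K irrP irrQ aE bE bba.
have bf : bijective f by exists f'.
have bf' : bijective f' by exists f.
have npr1 (A B : splitLocal F) : normal_ahom (pr1 A B).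
  by apply: normal_surj => y; exists (in1 A B y); rewrite pr1_in1.
pose c := comp_ahom f' (in1 Q R).
pose d := comp_ahom (pr1 Q R) f.
pose ab := comp_ahom a b.
pose h := comp_ahom d (in2 P P').
pose v := comp_ahom h (comp_ahom (pr2 P P') c).
have abE x : ab x = a (pr1 P P' (c x)) by rewrite !comp_lfunE bE.
have vE x : v x = h (pr2 P P' (c x)) by rewrite !comp_lfunE.
have na : normal_ahom a.
  have -> : a = comp_ahom d (in1 P P').
    by apply/val_inj/lfunP => x; rewrite !comp_lfunE aE.
  apply: normal_comp (normal_in1 _ _) _.
  exact: normal_comp (normal_bij bf) (npr1 _ _).
have nb : normal_ahom b.
  have -> : b = comp_ahom (pr1 P P') c.
    by apply/val_inj/lfunP => x; rewrite !comp_lfunE bE.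
  apply: normal_comp (npr1 _ _).
  exact: normal_comp (normal_in1 _ _) (normal_bij bf').
have abv x : x \in J Q -> x - ab x - v x \in J2 Q.
  move=> Jx; have Jc : c x \in J (sl_tensor P P').
    by rewrite (@J_ahom F Q (sl_tensor P P')).
  have := @J2_ahom F (sl_tensor P P') Q d _ (tensor_cotangent Jc).
  have dc : d (c x) = x by rewrite !comp_lfunE f'K pr1_in1.
  have dab : d (in1 P P' (pr1 P P' (c x))) = ab x.
    by rewrite abE aE /d [LHS]comp_lfunE.
  have dv : d (in2 P P' (pr2 P P' (c x))) = v x by rewrite vE /h [RHS]comp_lfunE.
  by rewrite !(linearB d) /= dc dab dv.
have bij_a : bijective a.
  have [[e abK Kab]|[n abn]] := fitting abE vE (normal_comp nb na) abv irrQ.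
    apply: surj_bij_lfun => [y|].
      by exists (b (e y)); rewrite -[RHS]Kab comp_lfunE.
    by apply: (inj_dim (f := a)) => x y E; apply: (bij_inj bba); rewrite E.
  (* If (ab)^n were the augmentation, then so would be (ba)^(n+1) = b (ab)^n a; being injective, it
     would force dim P = 1. *)
  have := irreducible_dim irrP; rewrite dim_aug // => x.
  have E m z : iter m.+1 (fun x => b (a x)) z = b (iter m ab (a z)).
    by elim: m => [|m IH] //; rewrite iterS IH /= comp_lfunE.
  have injn : injective (iter n.+1 (fun x => b (a x))).
    by elim: n.+1 => [|m IH] y z //= => /(bij_inj bba) /IH.
  apply: injn; rewrite !E !abn !aug_ahom.
  by rewrite aug_alg.
have PQ : alg_iso P Q by apply/alg_isoP; exists a.
split=> //; apply/alg_iso_sym/alg_isoP.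
pose r := comp_ahom (pr2 P P') (comp_ahom f' (in2 Q R)).
exists r; apply: surj_bij_lfun; last first.
  have : \dim {: tensor P P'} = \dim {: tensor Q R}.
    by apply: dim_alg_iso; apply/alg_isoP; exists f.
  rewrite !dim_tensor (dim_alg_iso PQ) => /eqP.
  by rewrite eqn_pmul2l ?dim_gt0 // => /eqP ->.
apply: surj_of_cotangent => x Jx.
pose t : sl_tensor Q R := f (in2 P P' x).
have Jt : t \in J (sl_tensor Q R).
  by rewrite (@J_ahom F (sl_tensor P P') (sl_tensor Q R))
    (@J_ahom F P' (sl_tensor P P')).
(* [p] is chosen so that the image [s] of its copy in P (x) P' has the same component in [Q] as [t].
   Modulo J^2 the difference t - s then comes from [R], while the projection to P' sends [t] to x
   and [s] to 0. *)
have [e _ eK] := bij_a; pose p := e (pr1 Q R t).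
have ap : a p = pr1 Q R t by rewrite eK.
have Jp : p \in J P by rewrite -(J_ahom a) ap (@J_ahom F (sl_tensor Q R) Q).
pose s : sl_tensor Q R := f (in1 P P' p).
have Js : s \in J (sl_tensor Q R).
  by rewrite (@J_ahom F (sl_tensor P P') (sl_tensor Q R))
    (@J_ahom F P (sl_tensor P P')).
exists (pr2 Q R t - pr2 Q R s).
have pr1s : pr1 Q R s = pr1 Q R t by rewrite -ap aE.
have := memvB (tensor_cotangent Jt) (tensor_cotangent Js); rewrite pr1s.
pose d' := comp_ahom (pr2 P P') f'.
move=> /(@J2_ahom F (sl_tensor Q R) P' d').
have d't : d' t = x by rewrite comp_lfunE fK pr2_in2.
have d's : d' s = 0.
  rewrite comp_lfunE fK pr2_in1; move: Jp; rewrite memJ => /eqP ->.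
  exact: scale0r.
have d'r y : d' (in2 Q R y) = r y by rewrite /r /d' !comp_lfunE.
have d'B y z : d' (y - z) = d' y - d' z by apply: linearB.
have rB y z : r (y - z) = r y - r z by apply: linearB.
rewrite !d'B d't d's !d'r rB sub0r.
set y := d' _; set z := r (pr2 Q R t); set w := r (pr2 Q R s).
by rewrite !opprB opprK (addrAC x) [w + y]addrC addrA subrK addrA addrAC.
Qed.




End Irreducible.

(** * Exchange and unique factorization *)

Section Uniqueness.
Variable F : fieldType.

Lemma in1_inj (A B : falgType F) : injective (in1 A B).
Proof.
apply/lker0P; rewrite -subv0; apply/subvP => a; rewrite memv_ker memv0 in1E.
by apply: contraLR => a0; rewrite tens_neq0 ?oner_neq0.
Qed.

Lemma in2_inj (A B : falgType F) : injective (in2 A B).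
Proof.
apply/lker0P; rewrite -subv0; apply/subvP => b; rewrite memv_ker memv0 in2E.
by apply: contraLR => b0; rewrite tens_neq0 ?oner_neq0.
Qed.

(** Each tensor factor embeds into [R], so [aug_inj] applies. *)
Lemma sl_factors (R : splitLocal F) (A B : falgType F)
    (f : 'AHom(R, tensor A B)) : bijective f ->
  (exists e : 'AHom(A, F^o), nilpotent_aug e) /\
  (exists e : 'AHom(B, F^o), nilpotent_aug e).
Proof.
move=> /bij_ahom_inv[g [fK gK]]; split.
  apply: (@aug_inj F A R (comp_ahom g (in1 A B))) => x y.
  by rewrite !comp_lfunE => /(can_inj gK)/in1_inj.
apply: (@aug_inj F B R (comp_ahom g (in2 A B))) => x y.
by rewrite !comp_lfunE => /(can_inj gK)/in2_inj.
Qed.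

Lemma tensor_iso (A B C D : falgType F) :
  alg_iso A C -> alg_iso B D -> alg_iso (tensor A B) (tensor C D).
Proof.
move=> /alg_isoP[f bf] /alg_isoP[g bg]; apply/alg_isoP.
by exists (tensor_map f g); apply: tensor_map_bij.
Qed.

Lemma tensor_family_eq n (P Q : 'I_n -> falgType F) :
  P =1 Q -> tensor_family P = tensor_family Q.
Proof. by move=> /funext ->. Qed.

Lemma lift_lift0 n (j : 'I_n.+1) : lift (lift ord0 j) ord0 = ord0.
Proof. exact/val_inj. Qed.

Lemma lift_liftS n (j : 'I_n.+1) (i : 'I_n) :
  lift (lift ord0 j) (lift ord0 i) = lift ord0 (lift j i).
Proof. by apply/val_inj; rewrite /= /bump !leq0n !add1n ltnS addnS. Qed.

Lemma pr1_tensorCA (A B C : splitLocal F) t :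
  pr1 B (sl_tensor A C) (tensorCA A B C t) = pr1 B C (pr2 A (sl_tensor B C) t).
Proof.
rewrite -!comp_lfunE.
apply: (eq_tensor_ahom3 (f := comp_ahom _ (tensorCA A B C)) (g := comp_ahom _ _)).
move=> a b c; rewrite !comp_lfunE.
rewrite tensorCAE (@pr1E F B (sl_tensor A C)) (@pr2E F A (sl_tensor B C)).
by rewrite linearZ /= pr1E aug_tens scalerA.
Qed.

(** The maps [f] and [g] are only required to be normal with bijective composite, so that the
    induction can replace [R] by its tail: [dichotomy] either selects the head of the family or
    supplies such maps for the tail. *)
Lemma find_factor (P : splitLocal F) : irreducible_algebra P ->
  forall m (Q : 'I_m.+1 -> falgType F) (R : splitLocal F)
    (f : 'AHom(P, R)) (g : 'AHom(R, P)),
  alg_iso R (tensor_family Q) -> normal_ahom f -> normal_ahom g ->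
  bijective (comp_ahom g f) ->
  exists (j : 'I_m.+1) (X Y : splitLocal F)
    (t : 'AHom(R, tensor X Y)) (t' : 'AHom(tensor X Y, R)),
  [/\ cancel t t' /\ cancel t' t, alg_iso X (Q j),
      alg_iso Y (tensor_family (fun i => Q (lift j i)))
    & bijective (fun x => g (t' (in1 X Y (pr1 X Y (t (f x))))))].
Proof.
move=> irrP; elim=> [|m IH] Q R f g /alg_isoP[t bt] nf ng bgf.
all: have [t' [tK t'K]] := bij_ahom_inv bt.
all: have [[eX nX] [eY nY]] := sl_factors bt.
all: pose X := SplitLocal nX; pose Y := SplitLocal nY.
all: have bt' : bijective t' by exists t.
all: have ntf : normal_ahom (comp_ahom t f)
  by apply: normal_comp nf (normal_bij bt).
all: have ngt : normal_ahom (comp_ahom g t')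
  by apply: normal_comp (normal_bij bt') ng.
all: have bgf' : bijective (comp_ahom (comp_ahom g t') (comp_ahom t f)).
1,3: by apply: (eq_bij bgf) => x; rewrite !comp_lfunE tK.
all: have [b1|b2] := @dichotomy F P X Y _ _ irrP ntf ngt bgf'.
1,3: exists ord0, X, Y, t, t'.
1,2: split; [by split | exact: alg_iso_refl | exact: alg_iso_refl |].
1,2: by apply: (eq_bij b1) => x; rewrite !comp_lfunE.
(* With a single factor the tail is [F], and [P] has dimension greater than 1, so it cannot embed
   there. *)
- suff /leq_trans/(_ (eq_leq (dim_regular F))) : (\dim {:P} <= \dim {: F^o})%N.
    by rewrite leqNgt irreducible_dim.
  apply: (inj_dim (f := comp_ahom (pr2 X Y) (comp_ahom t f))) => x y.
  rewrite !comp_lfunE => E; apply: (bij_inj b2); by rewrite !comp_lfunE E.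
pose f1 := comp_ahom (pr2 X Y) (comp_ahom t f).
pose g1 := comp_ahom (comp_ahom g t') (in2 X Y).
have nf1 : normal_ahom f1.
  apply: normal_comp => //; apply: normal_surj => y; exists (in2 X Y y).
  exact: pr2_in2.
have ng1 : normal_ahom g1 by apply: normal_comp => //; apply: normal_in2.
have bgf1 : bijective (comp_ahom g1 f1).
  by apply: (eq_bij b2) => x; rewrite !comp_lfunE.
have [j [X' [Y' [s [s' [[sK s'K] X'Q Y'Q bs]]]]]] :=
  IH (fun i => Q (lift ord0 i)) Y f1 g1 (alg_iso_refl Y) nf1 ng1 bgf1.
(* The tail splits as X' (x) Y' with X' the selected factor; it is moved in front of the head X,
   which joins Y' in the complement. *)
pose c := tensorCA X X' Y'; pose c' := tensorCA X' X Y'.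
pose r := comp_ahom c (comp_ahom (tensor_map (id_ahom X) s) t).
pose r' := comp_ahom t' (comp_ahom (tensor_map (id_ahom X) s') c').
have mK : cancel (tensor_map (id_ahom X) s) (tensor_map (id_ahom X) s').
  move=> x; rewrite -comp_lfunE -[RHS]id_lfunE.
  apply: (eq_tensor_ahom (f := comp_ahom _ _) (g := id_ahom _)) => a b.
  by rewrite comp_lfunE !tensor_mapE !id_lfunE sK.
have m'K : cancel (tensor_map (id_ahom X) s') (tensor_map (id_ahom X) s).
  move=> x; rewrite -comp_lfunE -[RHS]id_lfunE.
  apply: (eq_tensor_ahom (f := comp_ahom _ _) (g := id_ahom _)) => a b.
  by rewrite comp_lfunE !tensor_mapE !id_lfunE s'K.
exists (lift ord0 j), X', (sl_tensor X Y'), r, r'; split=> //.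
- split=> x; first by rewrite !comp_lfunE tensorCAK mK tK.
  by rewrite !comp_lfunE t'K m'K tensorCAK.
- apply: tensor_iso; first by rewrite lift_lift0; apply: alg_iso_refl.
  have E (i : 'I_m) :
      Q (lift ord0 (lift j i)) = Q (lift (lift ord0 j) (lift ord0 i)).
    by rewrite lift_liftS.
  apply: alg_iso_trans Y'Q _; rewrite (tensor_family_eq E).
  exact: alg_iso_refl.
apply: (eq_bij bs) => x; rewrite [f1 x]comp_lfunE [g1 _]comp_lfunE.
rewrite [comp_ahom g t' _]comp_lfunE [comp_ahom t f x]comp_lfunE.
have -> : pr1 X' (sl_tensor X Y') (r (f x)) = pr1 X' Y' (s (pr2 X Y (t (f x)))).
  rewrite [r _]comp_lfunE pr1_tensorCA comp_lfunE.
  by rewrite (@pr2_map F X Y X (sl_tensor X' Y')).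
set z := pr1 X' Y' _; congr (g _); rewrite [RHS]comp_lfunE; congr (t' _).
have c'E : c' (in1 X' (sl_tensor X Y') z) = tens 1 (in1 X' Y' z).
  by rewrite !in1E; apply: (tensorCAE z 1 1).
by rewrite comp_lfunE c'E tensor_mapE id_lfunE in2E.
Qed.

Lemma tensor_family_dim n (P : 'I_n.+1 -> falgType F) :
  (forall i, irreducible_algebra (P i)) -> (1 < \dim {: tensor_family P})%N.
Proof.
move=> irrP; rewrite dim_tensor.
by apply: leq_trans (irreducible_dim (irrP ord0)) _; rewrite leq_pmulr ?dim_gt0.
Qed.

(** Assembles the final reindexing: the first factor is matched with [j], the others with the
    indices different from [j]. *)
Lemma extend_bij n m (j : 'I_m.+1) (s : 'I_n -> 'I_m) : bijective s ->
  exists s1 : 'I_n.+1 -> 'I_m.+1, [/\ bijective s1, s1 ord0 = j &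
    forall i, s1 (lift ord0 i) = lift j (s i)].
Proof.
case=> s' sK s'K.
pose s1 i := if unlift ord0 i is Some k then lift j (s k) else j.
pose s2 k := if unlift j k is Some l then lift ord0 (s' l) else ord0 : 'I_n.+1.
exists s1; split=> [||i]; rewrite /s1 ?unlift_none ?liftK //.
exists s2 => i; rewrite /s2.
  by case: (unliftP ord0 i) => [k|] ->; rewrite ?liftK ?sK // unlift_none.
by case: (unliftP j i) => [k|] ->; rewrite ?liftK ?s'K // unlift_none.
Qed.

(** Induction on [n]: [find_factor] locates a partner for the first factor, [exchange] identifies
    both the partners and their complements, and the induction hypothesis is applied to the
    complement. Dimensions rule out an empty family against a nonempty one. *)
Theorem unique_factorization n m (P : 'I_n -> falgType F)
    (Q : 'I_m -> falgType F) (A : splitLocal F) :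
  (forall i, irreducible_algebra (P i)) ->
  (forall j, irreducible_algebra (Q j)) ->
  alg_iso A (tensor_family P) -> alg_iso A (tensor_family Q) ->
  n = m /\
  exists s : 'I_n -> 'I_m, bijective s /\ forall i, alg_iso (P i) (Q (s i)).
Proof.
elim: n m P Q A => [|n IH] [|m] P Q A irrP irrQ AP AQ.
- by split=> //; exists id; split=> [|[]//]; exists id.
- have := tensor_family_dim irrQ; rewrite -(dim_alg_iso AQ) (dim_alg_iso AP).
  by rewrite dim_regular.
- have := tensor_family_dim irrP; rewrite -(dim_alg_iso AP) (dim_alg_iso AQ).
  by rewrite dim_regular.
have [t bt] := (alg_isoP _ _).1 AP; have [t' [tK t'K]] := bij_ahom_inv bt.
have [[eX nX] [eY nY]] := sl_factors bt.
pose X := SplitLocal nX; pose Y := SplitLocal nY.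
pose f := comp_ahom t' (in1 X Y); pose g := comp_ahom (pr1 X Y) t.
have bt' : bijective t' by exists t.
have nf : normal_ahom f by apply: normal_comp (normal_in1 _ _) (normal_bij bt').
have ng : normal_ahom g.
  apply: normal_comp (normal_bij bt) _; apply: normal_surj => y.
  by exists (in1 X Y y); exact: (@pr1_in1 F X Y y).
(* The composite is the identity: the inclusion of the first factor followed by its projection. *)
have bgf : bijective (comp_ahom g f).
  by exists id => x; rewrite !comp_lfunE t'K pr1_in1.
have [j [Z [W [r [r' [[rK r'K] ZQ WQ bj]]]]]] :=
  @find_factor X (irrP ord0) m Q A f g AQ nf ng bgf.
have irrZ : irreducible_algebra Z.
  exact: irreducible_iso (alg_iso_sym ZQ) (irrQ j).
have [XZ YW] : alg_iso X Z /\ alg_iso Y W.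
  apply: (@exchange F X Y Z W (comp_ahom r t') (comp_ahom t r')
    (comp_ahom (pr1 Z W) (comp_ahom r f))
    (comp_ahom g (comp_ahom r' (in1 Z W)))) => //.
  - by move=> x; rewrite !comp_lfunE rK t'K.
  - by move=> x; rewrite !comp_lfunE tK r'K.
  - exact: irrP.
  - by move=> x; rewrite !comp_lfunE.
  - by move=> x; rewrite !comp_lfunE.
  by apply: (eq_bij bj) => x; rewrite !comp_lfunE.
have [|nm [s [bs sE]]] := IH m _ _ Y (fun i => irrP (lift ord0 i))
    (fun i => irrQ (lift j i)) (alg_iso_refl Y).
  exact: alg_iso_trans YW WQ.
split; first by rewrite nm.
have [s1 [bs1 s10 s1S]] := extend_bij j bs; exists s1; split=> // i.
have [k ->|->] := unliftP ord0 i; first by rewrite s1S.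
by rewrite s10; apply: alg_iso_trans XZ ZQ.
Qed.

End Uniqueness.

(** * Local algebras over a splitting field *)

Section LocalSplit.
Variable F : fieldType.

Lemma maximal_left_ideal_above (A : falgType F) (U : {vspace A}) :
  left_ideal U -> 1 \notin U ->
  exists2 M : {vspace A}, maximal_left_ideal M & (U <= M)%VS.
Proof.
move=> lU U1; pose Q n := `[< exists L : {vspace A},
  [/\ \dim L = n, left_ideal L, 1 \notin L & (U <= L)%VS] >].
have Q0 : exists n, Q n by exists (\dim U); apply/asboolP; exists U.
have Qle n : Q n -> (n <= \dim {:A})%N.
  by move=> /asboolP[L [<- _ _ _]]; apply/dimvS/subvf.
have [n /asboolP[M [dM lM M1 UM]] maxn] := ex_maxnP Q0 Qle.
exists M => //; split=> // [E|L lL ML]; first by rewrite E memvf in M1.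
have [L1|L1] := boolP (1 \in L); [right|left].
  apply/eqP; rewrite eqEsubv subvf; apply/subvP => x _.
  by rewrite -[x]mulr1; apply: ((left_idealP L).1 lL).
apply/esym/eqP; rewrite eqEdim ML dM; apply: maxn; apply/asboolP.
by exists L; split=> //; apply: subv_trans ML.
Qed.

(** Otherwise A (1 - x) would lie in a maximal left ideal, which also contains x and hence 1. *)
Lemma jacobson_left_inv (A : falgType F) (x : A) :
  x \in jacobson A -> exists y, y * (1 - x) = 1.
Proof.
move=> Jx; pose U := limg (amulr (1 - x)).
have UP y : y * (1 - x) \in U.
  by have := memv_img (amulr (1 - x)) (memvf y); rewrite lfunE.
have lU : left_ideal U.
  apply/left_idealP => a _ /memv_imgP[y _ ->]; rewrite lfunE /= mulrA.
  exact: UP.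
have [/memv_imgP[y _]|U1] := boolP (1 \in U).
  by rewrite lfunE; exists y.
have [M mM UM] := maximal_left_ideal_above lU U1.
have [/left_idealP lM pM _] := mM; case: pM; apply/eqP.
rewrite eqEsubv subvf; apply/subvP => z _; rewrite -[z]mulr1; apply: lM.
rewrite -(subrK x 1) memvD //; last exact: ((jacobsonP x).1 Jx).
by apply: (subvP UM); rewrite -[1 - x]mul1r.
Qed.

(** A power [N] of least dimension is idempotent. If it is nonzero, take a left ideal [L] of least
    dimension with N L nonzero, and x in [L] with N x nonzero. Minimality gives N x = L, so x = y x
    with y in the radical; as 1 - y is left invertible, x = 0. *)
Lemma jacobson_nilpotent (A : falgType F) : exists k, (jacobson A ^+ k = 0)%VS.
Proof.
set J := jacobson A; have [lJ _ _] := jacobson_ideal A.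
pose Q d := `[< exists k, \dim (J ^+ k.+1) = d >].
have Q0 : exists d, Q d by exists (\dim (J ^+ 1)); apply/asboolP; exists 0.
have [d /asboolP[k dk] dmin] := ex_minnP Q0.
have lJX n : ({:A} * J ^+ n.+1 <= J ^+ n.+1)%VS by rewrite expvSl prodvA prodvSl.
have JXJ n : (J ^+ n.+1 <= J)%VS.
  elim: n => [//|n IH]; rewrite expvSl; apply: subv_trans (prodvSl _ (subvf _)) _.
  exact: subv_trans (lJX n) IH.
set N := (J ^+ k.+1)%VS; have NN : (N * N = N)%VS.
  apply/eqP; rewrite eqEdim dk dmin ?andbT; last first.
    by apply/asboolP; exists (k + k.+1)%N; rewrite -expvD addSn.
  exact: subv_trans (prodvSl _ (subvf _)) (lJX k).
exists k.+1; apply/eqP; apply: contraT => nzN.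
pose R n := `[< exists L : {vspace A},
  [/\ \dim L = n, left_ideal L & (N * L)%VS != 0%VS] >].
have R0 : exists n, R n.
  by exists (\dim N); apply/asboolP; exists N; rewrite NN; split=> //; apply: lJX.
have [n /asboolP[L [dL lL NL]] minn] := ex_minnP R0.
have [x Lx Nx] : exists2 x, x \in L & (N * <[x]>)%VS != 0%VS.
  apply: contrapT => h; case/negP: NL; rewrite -subv0; apply/prodvP => y x Ny Lx.
  rewrite memv0; apply: contraT => yx; case: h; exists x => //.
  apply: contra yx => /eqP E; rewrite -memv0 -E.
  by rewrite memv_mul ?memv_line.
have NxL : (N * <[x]> <= L)%VS.
  apply: subv_trans (prodvS (subvf N) _) lL.
  by rewrite -memvE.
have NxE : (N * <[x]> = L)%VS.
  apply/eqP; rewrite eqEdim NxL dL minn //; apply/asboolP; exists (N * <[x]>)%VS.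
  split=> //; last by rewrite prodvA NN.
  by rewrite /left_ideal prodvA prodvSl ?lJX.
move: Lx; rewrite -NxE -limg_amulr => /memv_imgP[y Ny].
rewrite lfunE /= => E; have [z zE] := jacobson_left_inv (subvP (JXJ k) _ Ny).
case/eqP: Nx; suff -> : x = 0.
  apply/eqP; rewrite -subv0; apply/prodvP => u v _ /vlineP[c ->].
  by rewrite scaler0 mulr0 mem0v.
by rewrite -[x]mul1r -zE -mulrA mulrBl mul1r -E subrr mulr0.
Qed.

(** The obstructions are a matrix unit, which has a zero last row when the size exceeds 1, and the
    element (1, 0) of a product of at least two blocks. *)
Lemma division_matrix_product n (s : seq nat) :
    (forall x : matrix_product F n s, x != 0 -> exists y, x * y = 1) ->
  n = 0 /\ s = [::].
Proof.
case: s => [|m s] h.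
  split=> //; case: n h => // n h.
  have [|y] := h (delta_mx ord0 ord0).
    apply/eqP => /matrixP/(_ ord0 ord0); rewrite !mxE !eqxx => /eqP.
    by rewrite oner_eq0.
  move=> /matrixP/(_ ord_max ord_max); rewrite !mxE big1 => [/eqP|i _].
    by rewrite eqxx eq_sym oner_eq0.
  by rewrite !mxE mul0r.
have [|y /(congr1 snd)] := h (1, 0).
  by apply/eqP => /(congr1 fst)/eqP; rewrite oner_eq0.
by rewrite /= mul0r => /eqP; rewrite eq_sym oner_eq0.
Qed.

Lemma local_split_aug (A : falgType F) :
  local_algebra A -> splitting_field A ->
  exists e : 'AHom(A, F^o), nilpotent_aug e.
Proof.
move=> locA [n [s [f bf]]].
have [n0 s0] : n = 0 /\ s = [::].
  apply: division_matrix_product => x x0; have [g fK gK] := bf.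
  have gx0 : g x != 0.
    by apply: contra x0 => /eqP E; rewrite -(gK x) E raddf0.
  exists (f (g x)^-1); rewrite -{1}(gK x) -rmorphM divrr ?rmorph1 //.
  exact: locA.
subst n s; pose p := quotient_pi (jacobson_ideal A).
(* The quotient by the radical is now the algebra of 1 by 1 matrices; reading off the entry gives an
   augmentation whose kernel is the radical. *)
pose g (x : A) : F^o := (f (p x) : 'M[F]_1) ord0 ord0.
have lg : linear g.
  by move=> c x y; rewrite /g /p !linearP !mxE.
have mg : monoid_morphism g.
  split=> [|x y]; first by rewrite /g /p !rmorph1 mxE eqxx.
  by rewrite /g /p !rmorphM mxE big_ord1.
exists (mk_ahom lg mg); have [k Jk] := jacobson_nilpotent A; exists k.
suff -> : lker (mk_ahom lg mg) = jacobson A by [].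
apply/vspaceP => x; rewrite memv_ker mk_ahomE.
rewrite -(quotient_pi_eq0 (jacobson_ideal A)).
rewrite -/(p x) -(inj_eq (bij_inj bf)) raddf0; apply/eqP/eqP => [E|E].
  by apply/matrixP => i j; rewrite !ord1 [RHS]mxE.
by rewrite /g E mxE.
Qed.

End LocalSplit.

Theorem theorem1 (F : fieldType) (A : falgType F)
    (Alocal : local_algebra A) (Asplit : splitting_field A)
    (n m : nat) (P : 'I_n -> falgType F) (Q : 'I_m -> falgType F)
    (Pirr : forall i, irreducible_algebra (P i))
    (Qirr : forall j, irreducible_algebra (Q j))
    (AP : alg_iso A (tensor_family P)) (AQ : alg_iso A (tensor_family Q)) :
  n = m /\
  exists s : 'I_n -> 'I_m, bijective s /\ forall i, alg_iso (P i) (Q (s i)).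
Proof.
have [e ne] := local_split_aug Alocal Asplit.
exact: (@unique_factorization F n m P Q (SplitLocal ne)).
Qed.
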